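(* The uniform Roe algebra $C_u^*|\mathbb{Z}|$ has real rank zero.
   Context: A metric space $X$ has bounded geometry if for every $r>0$ there is a uniform bound on the cardinalities of all $r$-balls in $X$. For such $X$, $\mathbb{C}_u[X]$ is the $*$-algebra of all $X$-by-$X$ matrices $(a_{xy})$ with uniformly bounded entries in $\mathbb{C}$ whose propagation $\operatorname{prop}(a):=\sup\{d(x,y)\mid a_{xy}\neq 0\}$ is finite. As $X$ has bounded geometry, $\mathbb{C}_u[X]$ acts on $\ell^2(X)$ by bounded operators, and the uniform Roe algebra $C_u^*(X)$ is the operator-norm closure of the image of $\mathbb{C}_u[X]$ in this representation. When $X=G$ is a countable discrete group equipped with a left-invariant bounded geometry metric, one writes $C_u^*|G|$ for the uniform Roe algebra of $G$; for $G=\mathbb{Z}$ one may take the metric $d(m,n)=|m-n|$. A unital $C^*$-algebra $A$ has real rank zero if the set of self-adjoint elements with finite spectrum is norm dense in the set $A_{sa}$ of self-adjoint elements of $A$. *)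

(* Defs.v *)
From HB Require Import structures.
From mathcomp Require Import all_boot all_order all_algebra.
From mathcomp Require Import finmap.
From mathcomp Require Import all_classical all_reals all_analysis.
From mathcomp Require Import complex ring lra zify.

Set Implicit Arguments.
Unset Strict Implicit.
Unset Printing Implicit Defensive.

Import Order.TTheory GRing.Theory Num.Theory.
Import numFieldNormedType.Exports.

Local Open Scope classical_set_scope.
Local Open Scope card_scope.
Local Open Scope ring_scope.

(* R[i] is the field of complex numbers over a model R of the real numbers, and
   [Normc.normc] is its modulus, as an element of R. *)
Notation normc := Normc.normc.

Section Ell2.
Context (R : realType) (X : choiceType).

Definition sqnorm (v : X -> R[i]) : \bar R :=
  (\esum_(x in [set: X]) ((normc (v x)) ^+ 2)%:E)%E.

Definition ell2_pred : {pred (X -> R[i])} :=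
  [pred v | `[< (sqnorm v < +oo)%E >]].

Record ell2 : Type :=
  Ell2 { ell2_val :> X -> R[i]; ell2P : ell2_val \in ell2_pred }.

HB.instance Definition _ := [isSub for ell2_val].
HB.instance Definition _ := [Choice of ell2 by <:].

Lemma normc_ge0 (z : R[i]) : 0 <= normc z.
Proof. by case: z => a b; exact: sqrtr_ge0. Qed.

Lemma sqnorm_ge0 (v : X -> R[i]) : (0 <= sqnorm v)%E.
Proof. by apply: esum_ge0 => x _; rewrite lee_fin sqr_ge0. Qed.

Lemma esumZ_le (c : R) (f : X -> \bar R) (A : set X) : 0 <= c ->
  (forall x, 0 <= f x)%E ->
  (\esum_(x in A) (c%:E * f x) <= c%:E * \esum_(x in A) f x)%E.
Proof.
move=> c0 f0; apply: ge_ereal_sup => _ [F [finF FA] <-].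
rewrite -ge0_mule_fsumr//; apply: lee_wpmul2l; first by rewrite lee_fin.
by apply: esum_ge; exists F.
Qed.

Lemma sqnormD_le (a : R[i]) (u v : X -> R[i]) :
  (sqnorm (fun x => a * u x + v x)%R
    <= (2 * normc a ^+ 2)%:E * sqnorm u + 2%:E * sqnorm v)%E.
Proof.
have a2 : 0 <= 2 * normc a ^+ 2 by rewrite mulr_ge0 ?sqr_ge0.
apply: (@le_trans _ _ (\esum_(x in [set: X])
   ((2 * normc a ^+ 2)%:E * (normc (u x) ^+ 2)%:E
      + 2%:E * (normc (v x) ^+ 2)%:E))%E); last first.
  rewrite esumD => [|x _|x _]; last 2 first.
  - by rewrite -EFinM lee_fin mulr_ge0// sqr_ge0.
  - by rewrite -EFinM lee_fin mulr_ge0// sqr_ge0.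
  apply: leeD; apply: esumZ_le => // x; by rewrite lee_fin sqr_ge0.
apply: le_esum => x _; rewrite -!EFinM -EFinD lee_fin.
have h : normc (a * u x + v x) <= normc a * normc (u x) + normc (v x).
  by rewrite -Normc.normcM; exact: le_normcD.
apply: (@le_trans _ _ ((normc a * normc (u x) + normc (v x)) ^+ 2)).
  by rewrite ler_pXn2r// nnegrE ?normc_ge0// addr_ge0 ?mulr_ge0 ?normc_ge0.
rewrite -mulrA -exprMn; set p := _ * _; set q := normc _.
rewrite -subr_ge0 (_ : _ - _ = (p - q) ^+ 2) ?sqr_ge0//.
by ring.
Qed.

Lemma ell2_submod_closed : submod_closed ell2_pred.
Proof.
split=> [|a u v]; rewrite !inE/=.
  rewrite /sqnorm esum1// => x _.
  by rewrite (_ : normc _ = 0) ?expr0n//; exact: Normc.normc0.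
move=> u2 v2; apply: (le_lt_trans (sqnormD_le a u v)).
by rewrite lte_add_pinfty// lte_mul_pinfty// lee_fin// mulr_ge0 ?sqr_ge0.
Qed.

HB.instance Definition _ :=
  GRing.isSubmodClosed.Build _ _ ell2_pred ell2_submod_closed.
HB.instance Definition _ := [SubChoice_isSubLmodule of ell2 by <:].

(* Unconditional sums, meaningful for absolutely summable families. *)
Definition rsum (f : X -> R) : R :=
  fine (\esum_(x in [set: X]) (Num.max (f x) 0)%:E)%E
  - fine (\esum_(x in [set: X]) (Num.max (- f x) 0)%:E)%E.

Definition csum (f : X -> R[i]) : R[i] :=
  Complex (rsum (fun x => complex.Re (f x))) (rsum (fun x => complex.Im (f x))).

Definition ell2norm (v : ell2) : R := Num.sqrt (fine (sqnorm v)).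

Definition inner (v w : ell2) : R[i] := csum (fun x => v x * conjc (w x)).

Implicit Types (T S : ell2 -> ell2) (A : set (ell2 -> ell2)).

(* Valued in the extended reals, so that it is +oo for an unbounded map. *)
Definition opnorm T : \bar R :=
  ereal_sup [set (ell2norm (T v))%:E | v in [set v | ell2norm v <= 1]].

Definition bounded_operator T : Prop := linear T /\ (opnorm T < +oo)%E.

Definition operator_norm_closure A : set (ell2 -> ell2) :=
  [set T | bounded_operator T /\
    forall e : R, 0 < e -> exists2 S, A S & (opnorm (T \- S)%R < e%:E)%E].

Definition selfadjoint T : Prop :=
  forall v w : ell2, inner (T v) w = inner v (T w).

(* Below, A is to be thought of as a unital C*-algebra of bounded operators on
   l^2(X): its unit is [idfun], its product is composition, and the spectrum of
   an element is taken relative to A. *)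
Definition invertible_in A T : Prop :=
  exists S, [/\ A S, S \o T = idfun & T \o S = idfun].

Definition spectrum A T : set R[i] :=
  [set z | ~ invertible_in A (fun v => T v - z *: v)].

Definition real_rank_zero A : Prop :=
  forall T, A T -> selfadjoint T ->
  forall e : R, 0 < e ->
  exists S, [/\ A S, selfadjoint S, finite_set (spectrum A S)
              & (opnorm (T \- S)%R < e%:E)%E].

End Ell2.

Section UniformRoe.
Context {R : realType} (X : metricType R).

Definition bounded_geometry : Prop :=
  forall r : R, 0 < r ->
  exists N : nat, forall x : X, [set y | mdist x y <= r] #<= `I_N.

Definition propagation (a : X -> X -> R[i]) : \bar R :=
  ereal_sup [set (mdist p.1 p.2)%:E | p in [set p : X * X | a p.1 p.2 != 0]].

Definition Cu : set (X -> X -> R[i]) :=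
  [set a | (exists M : R, forall x y, normc (a x y) <= M)
           /\ (propagation a < +oo)%E].

(* When a is in [Cu] and X has bounded geometry, the rows of a have finite
   support, and the finitely supported sum below is the product of a with v. *)
Definition mx_apply (a : X -> X -> R[i]) (v : X -> R[i]) : X -> R[i] :=
  fun x => \sum_(y \in [set: X]) a x y * v y.

(* The image of C_u[X] in the operators on l^2(X); see [Cu_bounded_operator]
   for the fact that every a in C_u[X] does act. *)
Definition Cu_operators : set (ell2 R X -> ell2 R X) :=
  [set T | exists2 a, Cu a
         & forall v : ell2 R X, T v = mx_apply a v :> (X -> R[i])].

Definition uniform_Roe_algebra : set (ell2 R X -> ell2 R X) :=
  operator_norm_closure Cu_operators.

Lemma sqr_sum_le (I : Type) (s : seq I) (t : I -> R) :
  (\sum_(i <- s) t i) ^+ 2 <= (size s)%:R * \sum_(i <- s) t i ^+ 2.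
Proof.
elim: s => [|i s IH]; first by rewrite !big_nil expr0n mulr0.
rewrite !big_cons /=; set S := \sum_(j <- s) _ in IH *.
set Q := \sum_(j <- s) _ in IH *.
have [/size0nil s0|n0] := eqVneq (size s) 0%N.
  by rewrite /S /Q s0 !big_nil !addr0 mul1r.
have n_gt0 : 0 < (size s)%:R :> R by rewrite ltr0n lt0n.
rewrite -natr1; move: (size s)%:R n_gt0 IH => n n_gt0 IH.
have : 0 <= n * (n * t i ^+ 2 + Q - 2 * t i * S).
  have := sqr_ge0 (n * t i - S); nra.
rewrite pmulr_rge0//; nra.
Qed.

Lemma normc_sum (I : Type) (s : seq I) (t : I -> R[i]) :
  normc (\sum_(i <- s) t i) <= \sum_(i <- s) normc (t i).
Proof.
elim: s => [|i s IH]; first by rewrite !big_nil Normc.normc0.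
by rewrite !big_cons (le_trans (le_normcD _ _))// lerD2l.
Qed.

Section Action.
Variable a : X -> X -> R[i].
Hypotheses (hX : bounded_geometry) (ha : Cu a).

Lemma Cu_finite_rows : exists r : R, exists N : nat,
  (forall x : X, [set y | mdist x y <= r] #<= `I_N) /\
  (forall x y : X, r < mdist x y -> a x y = 0).
Proof.
have [_ pa] := ha; set r := Num.max (fine (propagation a)) 1.
have r0 : 0 < r by rewrite lt_max ltr01 orbT.
have [N hN] := hX r0; exists r, N; split=> // x y rxy.
apply/eqP/negP => /negP axy.
have : ((mdist x y)%:E <= propagation a)%E.
  by apply: ereal_sup_ubound; exists (x, y).
have : (propagation a <= r%:E)%E.
  rewrite /r; case: (propagation a) pa => [p _|//|_]; last exact: leNye.
  by rewrite lee_fin le_max lexx.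
by move=> h1 /le_trans/(_ h1); rewrite lee_fin leNgt rxy.
Qed.

Lemma mx_applyE r N : (forall x : X, [set y | mdist x y <= r] #<= `I_N) ->
  (forall x y : X, r < mdist x y -> a x y = 0) -> forall v x,
  mx_apply a v x = \sum_(y <- fset_set [set y | mdist x y <= r]) a x y * v y.
Proof.
move=> hN ar v x; rewrite /mx_apply.
rewrite -(@fsbig_widen _ _ _ _ [set y | mdist x y <= r])//.
  rewrite fsbig_finite//; apply: card_le_finite (hN x) _; exact: finite_II.
by move=> y [_ /= /negP]; rewrite -ltNge => /ar ->; rewrite mul0r.
Qed.

Lemma mx_apply_linear (c : R[i]) (u v : X -> R[i]) :
  mx_apply a (c *: u + v) = c *: mx_apply a u + mx_apply a v.
Proof.
have [r [N [hN ar]]] := Cu_finite_rows; apply/funext => x.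
change (mx_apply a (c *: u + v) x = c * mx_apply a u x + mx_apply a v x).
rewrite !(mx_applyE hN ar) mulr_sumr -big_split/=; apply: eq_bigr => y _.
change (a x y * (c * u y + v y) = c * (a x y * u y) + a x y * v y).
by rewrite mulrDr mulrCA.
Qed.

Lemma mx_apply_bounded : exists2 K : R, 0 <= K &
  forall v, (sqnorm (mx_apply a v) <= K%:E * sqnorm v)%E.
Proof.
have [r [N [hN ar]]] := Cu_finite_rows.
have [[M0 hM0] _] := ha; pose M := Num.max M0 0.
have M_ge0 : 0 <= M by rewrite le_max lexx orbT.
have hM x y : normc (a x y) <= M by rewrite (le_trans (hM0 x y))// le_max lexx.
pose B (x : X) := [set y | mdist x y <= r].
have finB x : finite_set (B x).
  by apply: card_le_finite (hN x) _; exact: finite_II.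
have cardB x : (size (fset_set (B x)) <= N)%N.
  by rewrite (geq_card_fset_set (hN x)).
exists (M ^+ 2 * N%:R * N%:R); first by rewrite !mulr_ge0 ?sqr_ge0.
move=> v; pose g y := ((normc (v y)) ^+ 2)%:E.
have g0 y : (0 <= g y)%E by rewrite lee_fin sqr_ge0.
have c0 : 0 <= M ^+ 2 * N%:R by rewrite !mulr_ge0 ?sqr_ge0.
apply: (@le_trans _ _ (\esum_(x in [set: X])
    ((M ^+ 2 * N%:R)%:E * \esum_(y in B x) g y))%E).
  apply: le_esum => x _; rewrite (mx_applyE hN ar) esum_fset//.
  rewrite fsbig_finite//= sumEFin -EFinM lee_fin.
  set s := fset_set _.
  apply: (@le_trans _ _ ((M * \sum_(y <- s) normc (v y)) ^+ 2)).
    rewrite ler_pXn2r ?nnegrE ?normc_ge0//; last first.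
      by rewrite mulr_ge0// sumr_ge0// => y _; exact: normc_ge0.
    rewrite (le_trans (normc_sum _ _))// mulr_sumr ler_sum// => y _.
    by rewrite Normc.normcM ler_wpM2r// normc_ge0.
  rewrite exprMn -[leRHS]mulrA ler_wpM2l ?sqr_ge0// (le_trans (sqr_sum_le _ _))//.
  apply: ler_wpM2r; last by rewrite ler_nat cardB.
  by apply: sumr_ge0 => y _; rewrite sqr_ge0.
apply: (le_trans (esumZ_le _ c0 _)) => [x|]; first exact: esum_ge0.
rewrite (EFinM (M ^+ 2 * N%:R)) -muleA; apply: lee_wpmul2l; first by rewrite lee_fin.
rewrite esum_esum//.
pose sw (p : X * X) := (p.2, p.1).
have swE : set_bij ([set: X] `*`` B) ([set: X] `*`` B) sw.
  split=> [[x y] [_]|[x y] [x' y'] _ _ [-> ->]//|[x y] [_]] /=; rewrite /B/=.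
  - by rewrite metric_sym.
  - by rewrite metric_sym => yx; exists (y, x).
rewrite (@reindex_esum R _ _ _ _ sw _ swE) /=.
rewrite -(@esum_esum _ _ _ [set: X] B (fun x _ => g x))//.
apply: (le_trans _ (esumZ_le _ (ler0n _ _) g0)).
apply: le_esum => x _; rewrite esum_fset// fsbig_finite//=.
rewrite /g sumEFin -EFinM lee_fin big_const_seq count_predT iter_addr_0.
by rewrite -[leLHS]mulr_natl ler_wpM2r ?sqr_ge0// ler_nat cardB.
Qed.

Lemma Cu_bounded_operator : exists2 T : ell2 R X -> ell2 R X,
  bounded_operator T & forall v, T v = mx_apply a v :> (X -> R[i]).
Proof.
have [K K0 hK] := mx_apply_bounded.
have l2 (v : ell2 R X) : mx_apply a v \in @ell2_pred R X.
  rewrite inE/=; apply: le_lt_trans (hK v) _.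
  by rewrite lte_mul_pinfty//; have := ell2P v; rewrite inE.
exists (fun v => Ell2 (l2 v)) => //; split.
  by move=> c u v; apply: val_inj; exact: mx_apply_linear.
apply: (@le_lt_trans _ _ (Num.sqrt K)%:E); last exact: ltry.
apply: ge_ereal_sup => _ [v v1 <-]; rewrite lee_fin /ell2norm ler_wsqrtr//=.
have vf : sqnorm v \is a fin_num.
  by rewrite ge0_fin_numE ?sqnorm_ge0//; have := ell2P v; rewrite inE.
have v_le1 : fine (sqnorm v) <= 1.
  by move: v1; rewrite /= /ell2norm -[leRHS]sqrtr1 ler_sqrt.
rewrite -lee_fin fineK; last first.
  by rewrite ge0_fin_numE ?sqnorm_ge0//; have := l2 v; rewrite inE.
apply: (le_trans (hK v)); rewrite -[leRHS]mule1 lee_wpmul2l ?lee_fin//.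
by rewrite -(fineK vf) lee_fin.
Qed.

End Action.
End UniformRoe.

Arguments Cu {R} X _ : rename.
Arguments Cu_operators {R} X _ : rename.
Arguments uniform_Roe_algebra {R} X _ : rename.

(* The integers with the metric |m - n|. *)
Definition Zmet (R : realType) : Type := int.

Section IntegerMetric.
Context (R : realType).

HB.instance Definition _ := Choice.copy (Zmet R) int.

Definition Zdist (m n : Zmet R) : R := (`|(m : int) - n|)%:~R.

Lemma Zdistxx m : Zdist m m = 0.
Proof. by rewrite /Zdist subrr normr0. Qed.

Lemma Zdist_positivity m n : Zdist m n = 0 -> m = n.
Proof.
by move=> /eqP; rewrite /Zdist intr_eq0 normr_eq0 subr_eq0 => /eqP.
Qed.

Lemma Zdist_sym m n : Zdist m n = Zdist n m.
Proof. by rewrite /Zdist distrC. Qed.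

Lemma Zdist_triangle n m p : Zdist m p <= Zdist m n + Zdist n p.
Proof. by rewrite /Zdist -intrD ler_int ler_distD. Qed.

HB.instance Definition _ := isMetric.Build R (Zmet R)
  Zdistxx Zdist_positivity Zdist_sym Zdist_triangle.

Lemma Zmet_bounded_geometry : bounded_geometry (Zmet R).
Proof.
move=> r r0; pose k := `|Num.ceil r|%N.
exists (k + k).+1 => m.
apply: (@card_le_trans _ _ _
    ((fun i : nat => (m : int) - k%:Z + i%:Z) @` `I_(k + k).+1));
  last exact: card_image_le.
apply: subset_card_le => y /= my.
have : `|(m : int) - y| <= k%:Z.
  rewrite -(ler_int R); apply: (le_trans my).
  rewrite (le_trans (ceil_ge r))// ler_int; exact: lez_abs.
rewrite ler_norml => /andP[h1 h2].
have h : 0 <= (y : int) - m + k%:Z by lia.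
exists (absz ((y : int) - m + k%:Z)); first by rewrite /=; lia.
by rewrite gez0_abs//; lia.
Qed.

End IntegerMetric.

(* Main.v *)
Require Import Defs.
From mathcomp Require Import all_boot all_order all_algebra.
From mathcomp Require Import all_classical all_reals all_analysis.
From mathcomp Require Import complex ring lra zify.

(** Let T be a self-adjoint element of the uniform Roe algebra of the integers.
    Up to a small error T is the operator of a self-adjoint matrix h with
    h x y = 0 for |x - y| > w and bounded entries.  Real rank zero follows once
    h is approximated by a matrix that is block diagonal, with blocks of
    bounded size, in an orthonormal basis of vectors supported in windows of
    bounded size: the blocks can then be diagonalized, and the eigenvalues
    rounded to a finite grid.

    To produce such a basis, the integers are cut into consecutive segments of
    the same length L.  In each segment one needs a finite rank projection p
    with these properties: p fixes the first w coordinate vectors, its range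
    vanishes on the last w coordinates, and (1 - p) h p is small.  Let q be the
    complement of p in the segment.  By the support conditions, the only
    entries of h that join two consecutive segments go from the range of q in
    the left one to the range of p in the right one.  Deleting the small
    entries between p and q inside each segment leaves a matrix that is block
    diagonal for the grouping (q of a segment, p of the next segment)
    ([adapted_blocks], [finite_spectrum_approx]).

    The point is that L must not depend on the segment.  Adding one vector at a
    time, it is enough to find, for one vector v and a self-adjoint matrix A
    with 0 <= A <= 1, a projection p onto a space of vectors f(A) v, f a
    polynomial of degree at most n, such that p v = v and (1 - p) A p is small,
    where n depends only on the precision ([hproj_containing_vector]; the
    induction is [hproj_containing_first_coordinates]).  In the spectral
    representation of A this is a statement on a finite measure on [0, 1].
    Sharp spectral projections onto short intervals would give an orthogonal
    decomposition of v into almost eigenvectors, but they are not polynomials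
    of bounded degree.  Sums of Bernstein polynomials of degree n over groups
    of consecutive indices are used in their place: they are nonnegative with
    sum 1, and each is concentrated near a short interval.  A pigeonhole
    argument places the boundaries between the groups where the measure is
    small, so that the pieces of v are almost orthogonal, and the groups of
    small mass are merged into the heaviest one, so that no piece is
    negligible compared with the errors ([almost_eigen_pieces]).

    Self-adjointness is essential: the sum of p and of the projection onto the
    coordinates before the segment almost commutes with h, and if h were the
    bilateral shift, this would be excluded by the Fredholm index. *)

Set Implicit Arguments.
Unset Strict Implicit.
Unset Printing Implicit Defensive.

Import Order.TTheory GRing.Theory Num.Theory.

Local Open Scope ring_scope.

(** * Bernstein polynomials *)

Section Bernstein.
Context {R : realType}.
Implicit Types (x : R) (n j : nat).

Definition bern n j x : R := 'C(n, j)%:R * (x ^+ j * (1 - x) ^+ (n - j)).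

Lemma bern_ge0 n j x : 0 <= x <= 1 -> 0 <= bern n j x.
Proof.
by case/andP=> x0 x1; rewrite !mulr_ge0 ?exprn_ge0// subr_ge0.
Qed.

(** The recurrence of the binomial distribution: one more trial succeeds with
    probability x. *)
Lemma bern_sumS n x (f : nat -> R) :
  \sum_(j < n.+2) f j * bern n.+1 j x =
  x * (\sum_(j < n.+1) f j.+1 * bern n j x)
  + (1 - x) * \sum_(j < n.+1) f j * bern n j x.
Proof.
have b0 : bern n n.+1 x = 0 by rewrite /bern bin_small// mul0r.
have -> : \sum_(j < n.+1) f j * bern n j x =
    f 0%N * bern n 0 x + \sum_(j < n.+1) f j.+1 * bern n j.+1 x.
  rewrite [in RHS]big_ord_recr /= b0 mulr0 addr0 big_ord_recl.
  by congr (_ + _); apply: eq_bigr => j _.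
rewrite big_ord_recl mulrDr !mulr_sumr [RHS]addrCA -big_split /=; congr (_ + _).
  by rewrite /bern !bin0 !subn0 !expr0 exprS; ring.
apply: eq_bigr => j _; rewrite /bump /= add1n /bern binS natrD subSS exprS.
have [jn|nj] := ltnP j n; last by rewrite (bin_small (_ : (n < j.+1)%N))//; ring.
by rewrite -(subnSK jn) exprS; ring.
Qed.

Lemma bern_sum n x : \sum_(j < n.+1) bern n j x = 1.
Proof.
elim: n => [|n IH]; first by rewrite big_ord1 /bern !expr0 !mul1r.
have one k m : \sum_(j < k) (fun=> 1 : R) (j : nat) * bern m j x =
    \sum_(j < k) bern m j x by apply: eq_bigr => j _; rewrite mul1r.
by have := bern_sumS n x (fun=> 1); rewrite !one IH => ->; ring.
Qed.

(** The second moment of the binomial distribution about an arbitrary point; the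
    free parameter a makes the induction on n work. *)
Lemma bern_var n x a : \sum_(j < n.+1) (j%:R - a) ^+ 2 * bern n j x =
  (n%:R * x - a) ^+ 2 + n%:R * (x * (1 - x)).
Proof.
elim: n a => [|n IH] a; first by rewrite big_ord1 /bern bin0 /=; ring.
rewrite (bern_sumS n x (fun j => (j%:R - a) ^+ 2)) IH.
under eq_bigr do rewrite -natr1 -addrA -[1 - a]opprB.
by rewrite IH -natr1; ring.
Qed.

(** Chebyshev: both indices j and k would have to be close to n x for the product
    to be large, and n x (1 - x) <= n / 4. *)
Lemma bern_far_pairs n x (l : nat) (P : nat -> nat -> bool) :
  0 <= x <= 1 -> (0 < l)%N ->
  (forall j k, P j k -> (l <= `|j%:Z - k%:Z|)%N) ->
  \sum_(j < n.+1) \sum_(k < n.+1 | P j k) bern n j x * bern n k x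
   <= n%:R / l%:R ^+ 2.
Proof.
move=> x01 l0 hP; have l2 : 0 < l%:R ^+ 2 :> R by rewrite exprn_gt0// ltr0n.
rewrite ler_pdivlMr// mulr_suml.
pose h (j : nat) : R := (j%:R - n%:R * x) ^+ 2.
have hs : \sum_(j < n.+1) h j * bern n j x = n%:R * (x * (1 - x)).
  by rewrite bern_var subrr expr0n add0r.
apply: (@le_trans _ _ (\sum_(j < n.+1) \sum_(k < n.+1)
   2 * (h j * bern n j x * bern n k x + bern n j x * (h k * bern n k x)))).
  apply: ler_sum => j _; rewrite mulr_suml big_mkcond; apply: ler_sum => k _.
  have b0 := mulr_ge0 (bern_ge0 n j x01) (bern_ge0 n k x01).
  rewrite (_ : 2 * _ = 2 * (h j + h k) * (bern n j x * bern n k x)); last by ring.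
  have hh : 0 <= h j + h k by rewrite addr_ge0// sqr_ge0.
  case: ifPn => [Pjk|_]; last exact: mulr_ge0 (mulr_ge0 (ler0n _ 2) hh) b0.
  rewrite mulrC ler_wpM2r//.
  have : (l%:R : R) <= `|j%:R - k%:R|.
    by rewrite !pmulrn -intrB -intr_norm ler_int; have := hP _ _ Pjk; lia.
  move=> /(lerXn2r 2); rewrite !nnegrE ler0n normr_ge0 => /(_ isT isT).
  rewrite real_normK ?num_real// => jk; apply: (le_trans jk); rewrite /h.
  have := sqr_ge0 ((j%:R - n%:R * x) + (k%:R - n%:R * x) : R); nra.
under eq_bigr => j _ do rewrite -mulr_sumr big_split /= -!mulr_sumr hs bern_sum.
rewrite -mulr_sumr big_split /= -!mulr_suml hs bern_sum.
have := sqr_ge0 (1 - 2 * x); have : 0 <= n%:R :> R by []; nra.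
Qed.

Lemma bern_var_node n x : (0 < n)%N ->
  \sum_(j < n.+1) (x - j%:R / n%:R) ^+ 2 * bern n j x <= 1 / (4 * n%:R).
Proof.
move=> n_gt0; have : 0 < n%:R :> R by rewrite ltr0n.
have : \sum_(j < n.+1) (x - j%:R / n%:R) ^+ 2 * bern n j x =
    \sum_(j < n.+1) (1 / n%:R ^+ 2) * ((j%:R - n%:R * x) ^+ 2 * bern n j x).
  apply: eq_bigr => j _; rewrite [RHS]mulrA; congr (_ * _).
  have : n%:R != 0 :> R by rewrite pnatr_eq0 -lt0n.
  by move: (n%:R : R) (j%:R : R) => N J N0; field.
rewrite -mulr_sumr bern_var subrr expr0n add0r => ->.
move: (n%:R : R) => N N_gt0.
have N0 : N != 0 by rewrite gt_eqF.
have -> : 1 / N ^+ 2 * (N * (x * (1 - x))) = (x * (1 - x)) / N by field.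
have -> : 1 / (4 * N) = (1 / 4) / N by field.
by rewrite ler_pM2r ?invr_gt0//; have := sqr_ge0 (1 - 2 * x); lra.
Qed.

End Bernstein.

(** * Cutting an interval of indices into far apart groups *)

Section Labels.
Local Open Scope nat_scope.
Variables (l r rho : nat).
Hypotheses (l_gt0 : 0 < l) (rho_lt : rho < r).

(** Indices are grouped into subblocks of l consecutive ones.  The subblocks
    congruent to rho modulo r are gaps; the r - 1 subblocks between two
    consecutive gaps form the group numbered by [grp].  The shift by r - rho
    makes the groups start right after a gap. *)
Definition gap (j : nat) := (j %/ l) %% r == rho.
Definition grp (j : nat) := (j %/ l + (r - rho)) %/ r.

Lemma grp_offset j : exists2 u, j %/ l + (r - rho) = grp j * r + u
  & (u < r) && ((u == 0) ==> gap j).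
Proof.
exists ((j %/ l + (r - rho)) %% r); first exact: divn_eq.
rewrite ltn_mod (leq_ltn_trans _ rho_lt)//=; apply/implyP => u0.
rewrite /gap -[X in _ == X](modn_small rho_lt) -(eqn_modDr (r - rho)).
by rewrite subnKC ?(ltnW rho_lt)// modnn.
Qed.

Lemma grp_far_lt j k : ~~ gap k -> grp j < grp k -> j + l <= k.
Proof.
move=> gk jk; have [u uE /andP[ur _]] := grp_offset j.
have [v vE /andP[_]] := grp_offset k; rewrite (negPf gk) implybF -lt0n => v0.
have jE := divn_eq j l; have := ltn_pmod j l_gt0; have kE := divn_eq k l.
have : grp j * r + r <= grp k * r by rewrite -mulSnr leq_mul2r jk orbT.
have s : j %/ l + 2 <= k %/ l -> (j %/ l + 2) * l <= k %/ l * l.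
  by move=> h; rewrite leq_mul2r h orbT.
rewrite mulnDl in s; nia.
Qed.

(** A whole gap lies between two distinct groups. *)
Lemma grp_far j k : ~~ gap j -> ~~ gap k -> grp j != grp k ->
  l <= absz (j%:Z - k%:Z)%R.
Proof.
move=> gj gk; rewrite neq_ltn => /orP[/(grp_far_lt gk)|/(grp_far_lt gj)]; lia.
Qed.

Lemma grp_near j :
  grp j * (r * l) + rho * l <= j + r * l < grp j * (r * l) + rho * l + r * l.
Proof.
have [u uE /andP[ur _]] := grp_offset j.
have jE := divn_eq j l; have := ltn_pmod j l_gt0.
have {}uE : j %/ l * l + r * l = grp j * (r * l) + rho * l + u * l.
  rewrite mulnA -!mulnDl; congr (_ * _); lia.
have : u * l + l <= r * l by rewrite -mulSnr leq_mul2r ur orbT.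
lia.
Qed.

End Labels.

Section Measure.
Context {R : realType} (d : nat) (w x : 'I_d -> R).
Hypotheses (w_ge0 : forall i, 0 <= w i) (x01 : forall i, 0 <= x i <= 1).

Definition expect (f : R -> R) : R := \sum_i w i * f (x i).

Lemma expect_le f g : (forall y, 0 <= y <= 1 -> f y <= g y) ->
  expect f <= expect g.
Proof. by move=> fg; apply: ler_sum => i _; rewrite ler_wpM2l// fg. Qed.

Lemma expectD f g : expect (fun y => f y + g y) = expect f + expect g.
Proof. by rewrite -big_split; apply: eq_bigr => i _; rewrite mulrDr. Qed.

Lemma expectZ c f : expect (fun y => c * f y) = c * expect f.
Proof. by rewrite mulr_sumr; apply: eq_bigr => i _; rewrite mulrCA. Qed.

Lemma expect_sum (I : finType) (P : pred I) (f : I -> R -> R) :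
  expect (fun y => \sum_(i | P i) f i y) = \sum_(i | P i) expect (f i).
Proof.
rewrite /expect [RHS]exchange_big; apply: eq_bigr => i _.
by rewrite mulr_sumr.
Qed.

End Measure.

Section WeightedSquares.
Context {R : realType} (m : nat) (v c : 'I_m -> R).
Hypotheses (v_ge0 : forall g, 0 <= v g) (v_sum : \sum_g v g = 1).

(** Jensen's inequality for the square. *)
Lemma sqr_mean_le : (\sum_g c g * v g) ^+ 2 <= \sum_g c g ^+ 2 * v g.
Proof.
set a := \sum_g _; have : 0 <= \sum_g (c g - a) ^+ 2 * v g.
  by apply: sumr_ge0 => g _; rewrite mulr_ge0// sqr_ge0.
suff -> : \sum_g (c g - a) ^+ 2 * v g = \sum_g c g ^+ 2 * v g - a ^+ 2 by lra.
transitivity (\sum_g (c g ^+ 2 * v g - 2 * a * (c g * v g) + a ^+ 2 * v g)).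
  by apply: eq_bigr => g _; ring.
rewrite big_split sumrB /= -!mulr_sumr v_sum -/a; ring.
Qed.

(** A converse of [sqr_mean_le] when the weights are almost idempotent: the variance is
    half the sum of v g * v h * (c g - c h) ^ 2 over pairs, and
    (c g - c h) ^ 2 <= 2 c g ^ 2 + 2 c h ^ 2 for g different from h. *)
Lemma sqr_mean_ge :
  \sum_g c g ^+ 2 * v g - 2 * \sum_g c g ^+ 2 * (v g * (1 - v g))
    <= (\sum_g c g * v g) ^+ 2.
Proof.
set S := \sum_g _ * v g.
have pairs : \sum_g \sum_h (c g ^+ 2 + c h ^+ 2) * (v g * v h) = 2 * S.
  transitivity (\sum_g (c g ^+ 2 * v g + S * v g)).
    apply: eq_bigr => g _; rewrite -[c g ^+ 2 * v g]mulr1 -{1}v_sum.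
    rewrite mulr_sumr mulr_suml -big_split; apply: eq_bigr => h _ /=; ring.
  by rewrite big_split /= -mulr_sumr v_sum -/S; ring.
have diag : \sum_g 2 * c g ^+ 2 * (v g * v g) <=
    (\sum_g c g * v g) ^+ 2 + \sum_g \sum_h (c g ^+ 2 + c h ^+ 2) / 2 * (v g * v h).
  rewrite expr2 mulr_suml -big_split; apply: ler_sum => g _ /=.
  rewrite mulr_sumr -big_split (bigD1 g) //= -[leLHS]addr0; apply: lerD.
    by rewrite le_eqVlt; apply/orP; left; apply/eqP; field.
  apply: sumr_ge0 => h _; have vv : 0 <= v g * v h by rewrite mulr_ge0.
  have := sqr_ge0 (c g + c h); nra.
have half : \sum_g \sum_h (c g ^+ 2 + c h ^+ 2) / 2 * (v g * v h) = S.
  transitivity ((2 * S) / 2); last by field.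
  rewrite -pairs mulr_suml; apply: eq_bigr => g _.
  by rewrite mulr_suml; apply: eq_bigr => h _; field.
suff -> : \sum_g c g ^+ 2 * (v g * (1 - v g)) =
    S - (\sum_g 2 * c g ^+ 2 * (v g * v g)) / 2 by move: diag half; lra.
by rewrite mulr_suml -sumrB; apply: eq_bigr => g _; field.
Qed.

End WeightedSquares.

(** * Bernstein pieces are almost eigenfunctions *)

Definition bern_part {R : realType} n (T : eqType) (G : 'I_n.+1 -> T) (g : T) (y : R) : R :=
  \sum_(j < n.+1 | G j == g) bern n j y.

(** The unit interval is cut into about M groups of r subblocks of l indices, so
    that the degree is n = M r l.  The number kappa bounds the overlaps of the
    pieces and tau is the least mass of a piece that is kept.  The hypotheses on
    these numbers say, in turn, that overlaps are negligible compared with tau,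
    that the heaviest group is kept, that at most half of the mass is lost in the
    gaps, that the relabelled mass is negligible compared with the heaviest
    group, and that the spread of the Bernstein polynomials is negligible. *)
Section Pieces.
Context {R : realType} (d : nat) (w x : 'I_d -> R).
Hypotheses (w_ge0 : forall i, 0 <= w i) (x01 : forall i, 0 <= x i <= 1).
Hypothesis w_sum : \sum_i w i = 1.
Local Notation E := (expect w x).

Variables (M r l : nat) (tau : R).
Hypotheses (M_gt0 : (0 < M)%N) (r_gt0 : (0 < r)%N) (l_gt0 : (0 < l)%N).
Let m := M.+2.
Let n := (M * (r * l))%N.
Let kappa : R := 2 / r%:R + n%:R / l%:R ^+ 2.
Hypotheses (kappa_tau : 4 * kappa <= tau) (tau_m : tau <= 1 / (2 * m%:R)).
Hypotheses (r_half : 1 / r%:R <= 1 / 2 :> R).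
Hypotheses (bad_small : 4 * (1 / r%:R + m%:R * tau) <= 1 / (M%:R ^+ 2 * m%:R)).
Hypotheses (var_small : 1 / (2 * n%:R) <= tau / M%:R ^+ 2).

Let n_gt0 : 0 < n%:R :> R. Proof. by rewrite ltr0n !muln_gt0 M_gt0 r_gt0. Qed.

Lemma expect_cst (a : R) : E (fun=> a) = a.
Proof. by rewrite /expect -mulr_suml w_sum mul1r. Qed.

Lemma expect_bern_le (P Q : pred 'I_n.+1) : (forall j, P j -> Q j) ->
  E (fun y => \sum_(j < n.+1 | P j) bern n j y) <=
  E (fun y => \sum_(j < n.+1 | Q j) bern n j y).
Proof.
move=> PQ; apply: expect_le => // y y01.
rewrite [leLHS]big_mkcond [leRHS]big_mkcond; apply: ler_sum => j _.
have := bern_ge0 n j y01; case: ifPn => [/PQ -> //|_]; by case: ifP.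
Qed.

(** The r families of gaps partition the indices, hence one of them carries at
    most the average mass. *)
Lemma light_gap : exists rho : 'I_r,
  E (fun y => \sum_(j < n.+1 | gap l r rho j) bern n j y) <= 1 / r%:R.
Proof.
pose z (rho : 'I_r) := E (fun y => \sum_(j < n.+1 | gap l r rho j) bern n j y).
have zsum : \sum_rho z rho = 1.
  rewrite -expect_sum -[RHS](expect_cst 1) /expect; apply: eq_bigr => i _.
  congr (_ * _); rewrite -(bern_sum n (x i)).
  rewrite [RHS](partition_big (fun j : 'I_n.+1 =>
    Ordinal (ltn_pmod (j %/ l) r_gt0)) xpredT) //=.
case: (Order.TotalTheory.arg_minP z (isT : xpredT (Ordinal r_gt0))) => rho _ rhoP.
exists rho; rewrite -/(z rho) ler_pdivlMr ?ltr0n// mulr_natr -zsum.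
rewrite -[in leLHS](card_ord r) -sumr_const; apply: ler_sum => i _; exact: rhoP.
Qed.

Let fm_gt0 : 0 < m%:R :> R. Proof. by rewrite ltr0n. Qed.
Let M1 : 1 <= M%:R :> R. Proof. by rewrite ler1n. Qed.
Let tau_gt0 : 0 < tau.
Proof.
have : 0 < kappa by rewrite addr_gt0// divr_gt0// ?exprn_gt0// ltr0n.
move: kappa_tau; lra.
Qed.

(** The space of combinations of the pieces is almost invariant under
    multiplication by the variable.  By [sqr_mean_ge] the pieces are almost
    orthogonal, so that the right-hand side is comparable with the sum of the
    c g ^ 2 weighted by the masses; by [sqr_mean_le] the left-hand side is at most
    the same sum with each mass multiplied by the mean square distance of the
    piece to the point t g. *)
Lemma almost_eigen_pieces_normalized : exists (G : 'I_n.+1 -> 'I_m) (t : 'I_m -> R),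
  forall c : 'I_m -> R,
  E (fun y => (\sum_g c g * (y - t g) * bern_part G g y) ^+ 2) <=
  10 / M%:R ^+ 2 * E (fun y => (\sum_g c g * bern_part G g y) ^+ 2).
Proof.
have [rho gap_le] := light_gap; pose lft (j : 'I_n.+1) := gap l r rho j.
have rho_r : (rho < r)%N by [].
pose gi (j : 'I_n.+1) : 'I_m := inord (grp l r rho j).
have giE j : gi j = grp l r rho j :> nat.
  rewrite inordK // /m ltnS; have /andP[h _] := grp_near l_gt0 rho_r j.
  have : (grp l r rho j * (r * l) <= M.+1 * (r * l))%N.
    rewrite mulSnr (leq_trans (leq_addr _ _) (leq_trans h _))// leq_add2r.
    by rewrite -ltnS.
  by rewrite leq_pmul2r// muln_gt0 r_gt0.
pose mass (g : 'I_m) :=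
  E (fun y => \sum_(j < n.+1 | ~~ lft j && (gi j == g)) bern n j y).
have mass_sum : \sum_g mass g = 1 - E (fun y => \sum_(j < n.+1 | lft j) bern n j y).
  rewrite -expect_sum; apply/eqP; rewrite eq_sym subr_eq -expectD.
  rewrite -[X in X == _](expect_cst 1) /expect; apply/eqP; apply: eq_bigr => i _.
  congr (_ * _); rewrite -(bern_sum n (x i)) (bigID lft) /= addrC; congr (_ + _).
  by rewrite (partition_big gi xpredT).
case: (Order.TotalTheory.arg_maxP mass (isT : xpredT (ord0 : 'I_m))) => g0 _ g0P.
have mass_g0 : 1 / (2 * m%:R) <= mass g0.
  rewrite ler_pdivrMr ?mulr_gt0//.
  have : \sum_g mass g <= \sum_(g : 'I_m) mass g0 by apply: ler_sum => g _; exact: g0P.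
  rewrite mass_sum sumr_const card_ord -mulr_natr; move: gap_le r_half; rewrite -/lft; lra.
(* Indices of gaps and of light groups are given to the heaviest group g0. *)
pose bad j := lft j || (mass (gi j) < tau).
pose G (j : 'I_n.+1) : 'I_m := if bad j then g0 else gi j.
pose t (g : 'I_m) : R := (g%:R * (r * l)%:R + (rho * l)%:R - (r * l)%:R) / n%:R.
exists G, t; pose v (g : 'I_m) (y : R) : R := bern_part G g y.
have v_ge0 (g : 'I_m) (y : R) : 0 <= y <= 1 -> 0 <= v g y.
  by move=> y01; apply: sumr_ge0 => j _; exact: bern_ge0.
have v_sum y : \sum_g v g y = 1.
  by rewrite -(bern_sum n y) [RHS](partition_big G xpredT).
have v_mass (g : 'I_m) : (forall j, G j != g) \/ (tau <= mass g /\ mass g <= E (v g)).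
  have [/existsP[j /eqP Gj]|/existsPn] := boolP [exists j, G j == g]; last by left.
  right; have tg : tau <= mass g.
    rewrite -Gj /G; case: ifPn => [_|]; first exact: le_trans tau_m mass_g0.
    by rewrite negb_or -leNgt => /andP[].
  split=> //; apply: expect_bern_le => k /andP[lk /eqP gk].
  by rewrite /G /bad (negPf lk) gk ltNge tg.
(* Two indices with different labels are far apart, unless one is in a gap. *)
have overlap (g : 'I_m) (y : R) : 0 <= y <= 1 -> v g y * (1 - v g y) <=
    2 * \sum_(j < n.+1 | lft j) bern n j y + n%:R / l%:R ^+ 2.
  move=> y01; have -> : 1 - v g y = \sum_(k < n.+1 | G k != g) bern n k y.
    rewrite -(bern_sum n y) (bigID (fun k => G k == g)) /=.
    by rewrite /v /bern_part addrAC subrr add0r.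
  pose far (j k : nat) := (l <= absz (j%:Z - k%:Z)%R)%N.
  have := @bern_far_pairs R n y l far y01 l_gt0 (fun j k h => h).
  set F := \sum_(j < _) _; move=> F_le.
  apply: (@le_trans _ _ (\sum_(j < n.+1) \sum_(k < n.+1)
     ((if lft j then bern n j y else 0) * bern n k y
      + bern n j y * (if lft k then bern n k y else 0)
      + (if far j k then bern n j y * bern n k y else 0)))).
    rewrite mulr_suml big_mkcond; apply: ler_sum => j _.
    have bj := bern_ge0 n j y01.
    have pos (k : 'I_n.+1) : 0 <= (if lft j then bern n j y else 0) * bern n k y
      + bern n j y * (if lft k then bern n k y else 0)
      + (if far j k then bern n j y * bern n k y else 0).
      have bk := bern_ge0 n k y01.
      by have := mulr_ge0 bj bk; case: (lft j); case: (lft k); case: (far j k); lra.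
    case: ifPn => [/eqP Gj|_]; last by apply: sumr_ge0 => k _; exact: pos.
    rewrite mulr_sumr big_mkcond; apply: ler_sum => k _.
    case: ifPn => [Gk|_]; last exact: pos.
    have bk := bern_ge0 n k y01; have bb := mulr_ge0 bj bk.
    have [lj|lj] := boolP (lft j).
      by rewrite -addrA lerDl; case: (lft k); case: (far j k);
        move: bb; lra.
    have [lk|lk] := boolP (lft k).
      by rewrite mul0r add0r lerDl; case: ifP.
    suff -> : far j k by rewrite mul0r mulr0 !add0r.
    apply: (grp_far l_gt0 rho_r lj lk); apply: contraNneq Gk => jk.
    have {}jk : gi j = gi k by apply: val_inj; rewrite /= !giE.
    by rewrite -Gj /G /bad (negPf lj) (negPf lk) jk.
  under eq_bigr do rewrite !big_split /= -!mulr_sumr -big_mkcond bern_sum -big_mkcond mulr1.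
  rewrite !big_split /= -big_mkcond -mulr_suml bern_sum mul1r.
  by rewrite -/F; set Z := \sum_(j < _ | _) _; move: F_le; lra.
have Eoverlap (g : 'I_m) : 4 * E (fun y => v g y * (1 - v g y)) <= tau.
  apply: le_trans kappa_tau; rewrite ler_wpM2l//.
  apply: (le_trans (expect_le w_ge0 x01 (overlap g))).
  rewrite expectD expectZ expect_cst lerD2r; move: gap_le; rewrite -/lft; lra.
have Ebad : 4 * E (fun y => \sum_(j < n.+1 | bad j) bern n j y)
    <= 1 / (M%:R ^+ 2 * m%:R).
  apply: le_trans bad_small; rewrite ler_wpM2l//.
  apply: (@le_trans _ _ (E (fun y => \sum_(j < n.+1 | lft j) bern n j y
      + \sum_(g | mass g < tau)
         \sum_(j < n.+1 | ~~ lft j && (gi j == g)) bern n j y))).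
    apply: expect_le => // y y01; rewrite (bigID lft) /=.
    rewrite (eq_bigl lft) => [|j]; last by rewrite /bad; case: (lft j); rewrite ?andbT ?andbF.
    rewrite lerD2l (partition_big gi (fun g => mass g < tau)) /=; last first.
      by move=> j; rewrite /bad; case: (lft j); rewrite ?andbT ?andbF.
    apply: ler_sum => g _; rewrite [leLHS]big_mkcond [leRHS]big_mkcond.
    apply: ler_sum => j _; have := bern_ge0 n j y01.
    by case: (lft j); rewrite /= ?andbF ?andbT//; case: (gi j == g); rewrite ?andbT ?andbF//; case: (bad j).
  rewrite expectD; apply: lerD; first exact: gap_le.
  rewrite expect_sum.
  apply: (@le_trans _ _ (\sum_(g : 'I_m) tau)); last first.
    by rewrite sumr_const card_ord mulr_natl.
  rewrite big_mkcond; apply: ler_sum => g _; case: ifPn => [/ltW//|_].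
  exact: ltW tau_gt0.
have rl_n : (r * l)%:R / n%:R = 1 / M%:R :> R.
  by rewrite /n natrM; field; rewrite !pnatr_eq0 !lt0n_neq0// ?muln_gt0 ?r_gt0.
have t_near j : ~~ bad j -> (j%:R / n%:R - t (G j)) ^+ 2 <= 1 / M%:R ^+ 2.
  move=> bj; rewrite /G (negPf bj) /t giE -mulrBl.
  have /andP[h1 h2] := grp_near l_gt0 rho_r j.
  move: h1 h2; rewrite -(ler_nat R) -(ltr_nat R) !natrD natrM => h1 h2.
  set a := (X in (X / _) ^+ 2).
  have a1 : 0 <= a / n%:R by rewrite divr_ge0// /a; lra.
  have a2 : a / n%:R <= 1 / M%:R by rewrite -rl_n ler_pM2r ?invr_gt0// /a; lra.
  have -> : 1 / M%:R ^+ 2 = (1 / M%:R) ^+ 2 :> R by rewrite expr_div_n expr1n.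
  nra.
have t_all (g : 'I_m) (y : R) : 0 <= y <= 1 -> (y - t g) ^+ 2 <= 4.
  move=> y01.
  have g1 : (g * (r * l) <= M.+1 * (r * l))%N by rewrite leq_mul2r -ltnS ltn_ord orbT.
  have r1 : (rho * l <= r * l)%N by rewrite leq_mul2r (ltnW rho_r) orbT.
  have r2 : (r * l <= n)%N by rewrite /n leq_pmull.
  have g2 : (g * (r * l) + rho * l <= n + n + r * l)%N.
    apply: (leq_trans (leq_add g1 r1)).
    by rewrite mulSnr -/n leq_add2r leq_add2l.
  rewrite -(ler_nat R) !natrD [X in X + _ <= _]natrM in g2; rewrite -(ler_nat R) in r2.
  have t2 : t g <= 2 by rewrite /t ler_pdivrMr//; lra.
  have t1 : -1 <= t g.
    rewrite /t ler_pdivlMr// mulN1r.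
    have : 0 <= g%:R * (r * l)%:R + (rho * l)%:R :> R by rewrite addr_ge0// mulr_ge0.
    lra.
  have d2 : (y - t g + 2) * (2 - (y - t g)) >= 0 by rewrite mulr_ge0//; lra.
  by move: d2; lra.
(* The indices of a group are within 1 / M of t g, up to the spread of the
   Bernstein polynomials; this fails only for relabelled indices, which all
   have the label g0 and a total mass negligible compared with that of g0. *)
have residual (g : 'I_m) : E (fun y => (y - t g) ^+ 2 * v g y) <= 5 / M%:R ^+ 2 * E (v g).
  have [Gg|[tg mg]] := v_mass g.
    have v0 y : v g y = 0 by apply: big1 => j /eqP Gj; have := Gg j; rewrite Gj eqxx.
    by rewrite /expect !big1// ?mulr0// => i _; rewrite v0 !mulr0.
  have pw (y : R) : 0 <= y <= 1 -> (y - t g) ^+ 2 * v g y <=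
      1 / (2 * n%:R) + 2 / M%:R ^+ 2 * v g y
      + (g == g0)%:R * (4 * \sum_(j < n.+1 | bad j) bern n j y).
    move=> y01; have -> : 1 / (2 * n%:R) = 2 * (1 / (4 * n%:R)) :> R.
      by move: (n%:R : R) n_gt0 => N N_gt0; field; rewrite gt_eqF.
    have var : 2 * \sum_(j < n.+1) (y - j%:R / n%:R) ^+ 2 * bern n j y
        <= 2 * (1 / (4 * n%:R)).
      by rewrite ler_wpM2l// bern_var_node// -(ltr0n R).
    apply: (le_trans _ (lerD (lerD var (lexx _)) (lexx _))).
    rewrite /v /bern_part !mulr_sumr (big_mkcond (fun j => G j == g)) /=.
    rewrite [X in _ + X + _]big_mkcond [X in _ + _ + X]big_mkcond -!big_split /=.
    apply: ler_sum => j _; have bj := bern_ge0 n j y01.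
    have sq : 0 <= 2 * ((y - j%:R / n%:R) ^+ 2 * bern n j y).
      by rewrite mulr_ge0// mulr_ge0// sqr_ge0.
    case: ifPn => [/eqP Gj|_]; last first.
      by rewrite addr0 addr_ge0//; case: ifP => // _; rewrite mulr_ge0// mulr_ge0.
    have M2 : 0 <= 2 / M%:R ^+ 2 * bern n j y by rewrite mulr_ge0// divr_ge0// sqr_ge0.
    have [bdj|bdj] := boolP (bad j).
      have -> : g = g0 by rewrite -Gj /G bdj.
      rewrite eqxx mul1r -[leLHS]add0r lerD ?addr_ge0// ler_wpM2r//.
      exact: t_all.
    rewrite addr0; have := t_near _ bdj; rewrite Gj => tj.
    have : (y - t g) ^+ 2 <= 2 * (y - j%:R / n%:R) ^+ 2 + 2 * (1 / M%:R ^+ 2).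
      by have := sqr_ge0 ((y - j%:R / n%:R) - (j%:R / n%:R - t g)); move: tj; lra.
    move=> /(ler_wpM2r bj) /le_trans -> //.
    by rewrite mulrDl -!mulrA mul1r.
  apply: (le_trans (expect_le w_ge0 x01 pw)).
  rewrite !expectD expectZ expect_cst expectZ expectZ.
  have vs : 1 / (2 * n%:R) <= E (v g) / M%:R ^+ 2.
    apply: (le_trans var_small); rewrite ler_wpM2r ?invr_ge0 ?sqr_ge0//.
    exact: le_trans mg.
  have gs : (g == g0)%:R * (4 * E (fun y => \sum_(j < n.+1 | bad j) bern n j y))
     <= 2 / M%:R ^+ 2 * E (v g).
    have [gg0|_] := eqVneq g g0; last first.
      by rewrite mul0r mulr_ge0// ?(le_trans (ltW tau_gt0) (le_trans tg mg))// divr_ge0// sqr_ge0.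
    rewrite mul1r; apply: (le_trans Ebad).
    have -> : 1 / (M%:R ^+ 2 * m%:R) = 2 / M%:R ^+ 2 * (1 / (2 * m%:R)) :> R.
      by field; rewrite !gt_eqF// (lt_le_trans _ M1).
    rewrite ler_wpM2l ?divr_ge0 ?sqr_ge0//; apply: (le_trans mass_g0).
    by rewrite -gg0.
  move: vs gs; move: (1 / (2 * _)) (_%:R * (4 * _)) (M%:R ^- 2) (E (v g)).
  by move=> a b i e; lra.
move=> c; apply: (@le_trans _ _ (\sum_g c g ^+ 2 * (5 / M%:R ^+ 2 * E (v g)))).
  apply: (@le_trans _ _ (E (fun y => \sum_g c g ^+ 2 * ((y - t g) ^+ 2 * v g y)))).
    apply: expect_le => // y y01.
    apply: (le_trans (sqr_mean_le _ (fun g => v_ge0 g y y01) (v_sum y))).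
    by apply: ler_sum => g _; rewrite exprMn mulrA.
  rewrite expect_sum; apply: ler_sum => g _; rewrite expectZ ler_wpM2l ?sqr_ge0//.
have -> : \sum_g c g ^+ 2 * (5 / M%:R ^+ 2 * E (v g)) =
    M%:R ^- 2 * (5 * \sum_g c g ^+ 2 * E (v g)).
  by rewrite !mulr_sumr; apply: eq_bigr => g _; ring.
rewrite [10 / _]mulrC -[X in _ <= X]mulrA ler_wpM2l ?invr_ge0 ?sqr_ge0//.
apply: (@le_trans _ _ (10 * \sum_g (c g ^+ 2 * E (v g)
   - 2 * (c g ^+ 2 * E (fun y => v g y * (1 - v g y)))))).
  rewrite !mulr_sumr; apply: ler_sum => g _.
  have c2 := sqr_ge0 (c g).
  have [Gg|[tg mg]] := v_mass g.
    have v0 y : v g y = 0 by apply: big1 => j /eqP Gj; have := Gg j; rewrite Gj eqxx.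
    have E0 : E (v g) = 0 by rewrite /expect big1// => i _; rewrite v0 mulr0.
    have -> : E (fun y => v g y * (1 - v g y)) = 0.
      by rewrite /expect big1// => i _; rewrite v0 mul0r mulr0.
    by rewrite E0 !mulr0 subr0 mulr0.
  have := Eoverlap g; have : tau <= E (v g) by exact: le_trans mg.
  set e1 := E _; set e2 := E _ => h1 h2.
  have : 0 <= c g ^+ 2 * (e1 - 4 * e2) by rewrite mulr_ge0// subr_ge0 (le_trans h2).
  lra.
rewrite ler_wpM2l// sumrB -mulr_sumr.
apply: (@le_trans _ _ (E (fun y => \sum_g c g ^+ 2 * v g y
   + (-2) * \sum_g c g ^+ 2 * (v g y * (1 - v g y))))).
  rewrite expectD expectZ !expect_sum mulNr lerD//.
    by apply: ler_sum => g _; rewrite expectZ.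
  by rewrite lerN2 ler_wpM2l//; apply: ler_sum => g _; rewrite expectZ.
apply: expect_le => // y y01; rewrite mulNr.
exact: sqr_mean_ge (fun g => v_ge0 g y y01) (v_sum y).
Qed.

End Pieces.

(** The degree is independent of the measure and of the number of its atoms. *)
Lemma almost_eigen_pieces_measure {R : realType} (M : nat) : (0 < M)%N ->
  exists n : nat, forall d (w x : 'I_d -> R),
  (forall i, 0 <= w i) -> (forall i, 0 <= x i <= 1) ->
  exists (G : 'I_n.+1 -> 'I_M.+2) (t : 'I_M.+2 -> R), forall c : 'I_M.+2 -> R,
  expect w x (fun y => (\sum_g c g * (y - t g) * bern_part G g y) ^+ 2) <=
  10 / M%:R ^+ 2 * expect w x (fun y => (\sum_g c g * bern_part G g y) ^+ 2).
Proof.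
move=> M_gt0; pose m := M.+2.
(* r is chosen large compared with 1 / tau, then l large compared with r / tau,
   where tau = 1 / (8 M ^ 2 m ^ 2). *)
pose r := (64 * M ^ 2 * m ^ 3)%N; pose l := (32 * m ^ 3 * M ^ 3 * r)%N.
have m_gt0 : (0 < m)%N by [].
have r_gt0 : (0 < r)%N by rewrite /r !muln_gt0 ?expn_gt0 ?M_gt0.
have l_gt0 : (0 < l)%N by rewrite /l !muln_gt0 ?expn_gt0 ?M_gt0 ?r_gt0.
exists (M * (r * l))%N => d w x w_ge0 x01.
have [w0|w_pos] := eqVneq (\sum_i w i) 0.
  have {}w0 i : w i = 0.
    by apply/eqP; move/eqP: w0; rewrite psumr_eq0// => /allP/(_ i); rewrite mem_index_enum => /(_ isT).
  exists (fun=> ord0), (fun=> 0) => c.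
  by rewrite /expect !big1 ?mulr0// => i _; rewrite w0 mul0r.
have W_gt0 : 0 < \sum_i w i by rewrite lt_def w_pos sumr_ge0.
pose W := \sum_i w i; pose w' i := w i / W.
have w'_sum : \sum_i w' i = 1 by rewrite -mulr_suml divff.
have w'_ge0 i : 0 <= w' i by rewrite divr_ge0// ltW.
have rE : r%:R = 64 * M%:R ^+ 2 * m%:R ^+ 3 :> R by rewrite -!natrX -!natrM.
have lE : l%:R = 32 * m%:R ^+ 3 * M%:R ^+ 3 * r%:R :> R by rewrite -!natrX -!natrM.
have M1 : 1 <= M%:R :> R by rewrite ler1n.
have m2 : 2 <= m%:R :> R by rewrite ler_nat.
pose tau : R := 1 / (8 * M%:R ^+ 2 * m%:R ^+ 2).
have nE : (M * (r * l))%:R = M%:R * (r%:R * l%:R) :> R by rewrite !natrM.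
have [] := @almost_eigen_pieces_normalized R d w' x w'_ge0 x01 w'_sum M r l tau M_gt0 r_gt0 l_gt0.
- rewrite nE lE rE /tau; move: (M%:R : R) (m%:R : R) M1 m2 => a b a1 b2.
  have a0 : 0 < a by lra.
  have b0 : 0 < b by lra.
  rewrite (_ : 4 * _ = 2 / b * (1 / (8 * a ^+ 2 * b ^+ 2))); last first.
    by field; rewrite !gt_eqF.
  apply: ler_piMl; last by rewrite ler_pdivrMr// mul1r.
  by rewrite ltW// divr_gt0// mulr_gt0 ?exprn_gt0// mulr_gt0 ?exprn_gt0.
- rewrite /tau -/m; move: (M%:R : R) (m%:R : R) M1 m2 => a b a1 b2.
  have a0 : 0 < a by lra.
  have b0 : 0 < b by lra.
  have a2 : 1 <= a ^+ 2 by rewrite exprn_ege1.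
  rewrite !mul1r lef_pV2 ?posrE; last 2 first.
  + by rewrite mulr_gt0 ?exprn_gt0// mulr_gt0 ?exprn_gt0.
  + by rewrite mulr_gt0.
  by nra.
- rewrite rE; move: (M%:R : R) (m%:R : R) M1 m2 => a b a1 b2.
  have a2 : 1 <= a ^+ 2 by rewrite exprn_ege1.
  have b3 : 1 <= b ^+ 3 by rewrite exprn_ege1//; lra.
  have ab : 1 <= a ^+ 2 * b ^+ 3 by nra.
  by rewrite !mul1r lef_pV2 ?posrE//; lra.
- rewrite rE /tau -/m; move: (M%:R : R) (m%:R : R) M1 m2 => a b a1 b2.
  have a0 : 0 < a by lra.
  have b0 : 0 < b by lra.
  rewrite (_ : 4 * _ = (1 / (16 * b ^+ 2) + 1 / 2) * (1 / (a ^+ 2 * b)));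
    last by field; rewrite !gt_eqF.
  apply: ler_piMl; first by rewrite ltW// divr_gt0// mulr_gt0 ?exprn_gt0.
  have : 1 / (16 * b ^+ 2) <= 1 / 2; last by lra.
  have b22 : 1 <= b ^+ 2 by rewrite exprn_ege1//; lra.
  by rewrite !mul1r lef_pV2 ?posrE//; lra.
- rewrite nE /tau; move: (M%:R : R) (m%:R : R) (r%:R : R) (l%:R : R) M1 m2 rE lE.
  move=> a b r' l' a1 b2 rE lE.
  have a0 : 0 < a by lra.
  have b0 : 0 < b by lra.
  have a2 : 1 <= a ^+ 2 by rewrite exprn_ege1.
  have b3 : 1 <= b ^+ 3 by rewrite exprn_ege1//; lra.
  have ab : 1 <= a ^+ 2 * b ^+ 3 by nra.
  have r1 : 1 <= r' by lra.
  have la : a <= l'.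
    have -> : l' = a * (32 * (a ^+ 2 * b ^+ 3) * r') by rewrite lE; ring.
    by rewrite ler_peMr ?ltW//; nra.
  have lar : a ^+ 2 * r' <= a * (r' * l').
    by rewrite expr2 -mulrA ler_pM2l// mulrC ler_pM2l//; lra.
  have arb : 4 * (a ^+ 4 * b ^+ 2) <= a ^+ 2 * r'.
    rewrite (_ : a ^+ 2 * r' = 4 * (a ^+ 4 * b ^+ 2) * (16 * b)); last by rewrite rE; ring.
    by rewrite ler_peMr ?mulr_ge0 ?exprn_ge0 ?ltW//; lra.
  rewrite (_ : _ / a ^+ 2 = 1 / (8 * (a ^+ 4 * b ^+ 2))); last by field; rewrite !gt_eqF.
  have p1 : 0 < a ^+ 4 * b ^+ 2 by rewrite mulr_gt0 ?exprn_gt0.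
  by rewrite !mul1r lef_pV2 ?posrE; lra.
move=> G [t Gt]; exists G, t => c; have := Gt c.
have scal f : expect w' x f = W^-1 * expect w x f.
  by rewrite mulr_sumr; apply: eq_bigr => i _; rewrite /w'; ring.
rewrite !scal mulrCA ler_pM2l ?invr_gt0//.
Qed.

Lemma almost_eigen_pieces {R : realType} (delta : R) : 0 < delta ->
  exists n m : nat, forall d (w x : 'I_d -> R),
  (forall i, 0 <= w i) -> (forall i, 0 <= x i <= 1) ->
  exists (G : 'I_n.+1 -> 'I_m) (t : 'I_m -> R), forall c : 'I_m -> R,
  expect w x (fun y => (\sum_g c g * (y - t g) * bern_part G g y) ^+ 2) <=
  delta * expect w x (fun y => (\sum_g c g * bern_part G g y) ^+ 2).
Proof.
move=> d0; pose M := (Num.bound (10 / delta)).+1.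
have [n nP] := @almost_eigen_pieces_measure R M (ltn0Sn _).
exists n, M.+2 => d w x w0 x01; have [G [t Gt]] := nP d w x w0 x01.
exists G, t => c; apply: (le_trans (Gt c)); rewrite ler_wpM2r//.
  by apply: sumr_ge0 => i _; rewrite mulr_ge0// sqr_ge0.
have b1 : 10 / delta < M%:R.
  have : 10 / delta < (Num.bound (10 / delta))%:R.
    by apply: archi_boundP; rewrite divr_ge0// ltW.
  by move=> h; apply: (lt_trans h); rewrite ltr_nat.
have M1 : 1 <= M%:R :> R by rewrite ler1n.
rewrite ler_pdivrMr ?exprn_gt0 ?(lt_le_trans _ M1)//.
rewrite ltr_pdivrMr// in b1; move: b1 M1; move: (M%:R : R) => a; nra.
Qed.

(** * Hermitian matrices and their projections *)

Local Open Scope sesquilinear_scope.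

Section HermitianLemmas.
Context {C : numClosedFieldType}.

Definition nrm2 d (u : 'rV[C]_d) : C := (u *m u^t*) 0 0.

Lemma trmxCM m n p (A : 'M[C]_(m, n)) (B : 'M[C]_(n, p)) :
  (A *m B)^t* = B^t* *m A^t*.
Proof. by rewrite trmx_mul map_mxM. Qed.

Lemma trmxCD m n (A B : 'M[C]_(m, n)) : (A + B)^t* = A^t* + B^t*.
Proof. by rewrite linearD /= map_mxD. Qed.

Lemma trmxCB m n (A B : 'M[C]_(m, n)) : (A - B)^t* = A^t* - B^t*.
Proof. by rewrite linearB /= map_mxB. Qed.

Lemma trmxC1 n : (1%:M : 'M[C]_n)^t* = 1%:M.
Proof. by rewrite trmx1 map_mx1. Qed.

Lemma nrm2E d (u : 'rV[C]_d) : nrm2 u = \sum_i `|u 0 i| ^+ 2.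
Proof. by rewrite /nrm2 mxE; apply: eq_bigr => i _; rewrite !mxE normCK. Qed.

Lemma nrm2_ge0 d (u : 'rV[C]_d) : 0 <= nrm2 u.
Proof. by rewrite nrm2E sumr_ge0// => i _; rewrite exprn_ge0. Qed.

Lemma nrm2_unitary d (U : 'M[C]_d) (u : 'rV[C]_d) : U *m U^t* = 1%:M ->
  nrm2 (u *m U) = nrm2 u.
Proof. by move=> UU; rewrite /nrm2 trmxCM mulmxA -(mulmxA u) UU mulmx1. Qed.

Definition hproj d (p : 'M[C]_d) := p^t* = p /\ p *m p = p.

Lemma hprojC d (p : 'M[C]_d) : hproj p -> hproj (1%:M - p).
Proof.
move=> [ph pp]; split; first by rewrite trmxCB trmxC1 ph.
by rewrite mulmxBr mulmx1 mulmxBl mul1mx pp subrr subr0.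
Qed.

Lemma hproj0 d : hproj (0 : 'M[C]_d).
Proof. by split; rewrite ?mul0mx// trmx0 map_mx0. Qed.

Lemma hprojD d (p q : 'M[C]_d) : hproj p -> hproj q -> p *m q = 0 ->
  hproj (p + q) /\ q *m p = 0.
Proof.
move=> [ph pp] [qh qq] pq.
have qp : q *m p = 0 by rewrite -ph -qh -trmxCM pq trmx0 map_mx0.
split=> //; split; first by rewrite trmxCD ph qh.
by rewrite mulmxDr !mulmxDl pp qq pq qp addr0 add0r.
Qed.

Lemma nrm2_hproj d (p : 'M[C]_d) (u : 'rV[C]_d) : hproj p ->
  nrm2 u = nrm2 (u *m p) + nrm2 (u *m (1%:M - p)).
Proof.
move=> hp; have [ph pp] := hp; have [qh qq] := hprojC hp.
rewrite /nrm2 !trmxCM ph qh !mulmxA -(mulmxA u p p) pp.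
rewrite -(mulmxA u (1%:M - p)) qq -[u^t*]mul1mx -{1}(addrNK p 1%:M).
by rewrite mulmxDl mulmxDr !mul1mx !mulmxA mxE addrC.
Qed.

Lemma nrm2_hproj_le d (p : 'M[C]_d) (u : 'rV[C]_d) : hproj p ->
  nrm2 (u *m p) <= nrm2 u.
Proof. by move=> hp; rewrite (nrm2_hproj u hp) lerDl nrm2_ge0. Qed.

Lemma nrm2D_le d (u v : 'rV[C]_d) : nrm2 (u + v) <= 2 * nrm2 u + 2 * nrm2 v.
Proof.
rewrite -subr_ge0; suff -> : 2 * nrm2 u + 2 * nrm2 v - nrm2 (u + v) = nrm2 (u - v).
  exact: nrm2_ge0.
by rewrite /nrm2 trmxCD trmxCB !mulmxDl !mulmxDr !mulNmx !mulmxN !mxE; ring.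
Qed.

(** With an orthonormal basis Q of the row space of X, the projection is Q^t* Q.
    Vectors are rows, on which matrices act from the right. *)
Lemma hproj_rowspace m d (X : 'M[C]_(m, d)) :
  exists p : 'M[C]_d, [/\ hproj p, X *m p = X & (p <= X)%MS].
Proof.
pose Q := schmidt (row_base X).
have QQ : Q *m Q^t* = 1%:M.
  by apply/unitarymxP; rewrite schmidt_unitarymx// rank_leq_col.
have QX : (Q :=: X)%MS.
  by apply: eqmx_trans (eq_row_base X); apply: eqmx_schmidt_free; exact: row_base_free.
exists (Q^t* *m Q); split.
- by split; rewrite ?trmxCM ?trmxCK// mulmxA -(mulmxA _ Q) QQ mulmx1.
- have /submxP[D XD] : (X <= Q)%MS by rewrite QX.
  by rewrite [X in X *m _]XD mulmxA -(mulmxA D) QQ mulmx1 -XD.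
- by rewrite -QX submxMl.
Qed.

Lemma spectral_hermitian d (A : 'M[C]_d) : A^t* = A ->
  exists (U : 'M[C]_d) (s : 'rV[C]_d), [/\ U *m U^t* = 1%:M, U^t* *m U = 1%:M,
    A = U^t* *m diag_mx s *m U & forall i, s 0 i \is Num.real].
Proof.
move=> Ah; have hA : A \is hermsymmx.
  by apply/is_hermitianmxP; rewrite expr0 scale1r.
have /orthomx_spectralP AE := hermitian_normalmx hA.
have unU := spectral_unitarymx A; rewrite invmx_unitary// in AE.
exists (spectralmx A), (spectral_diag A); split=> //.
- exact/unitarymxP.
- by apply/mulmx1C/unitarymxP.
- by move=> i; apply: (mxOverP (hermitian_spectral_diag_real hA)).
Qed.

End HermitianLemmas.

Section OneVector.
Context {R : realType}.
Local Open Scope complex_scope.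
Local Notation C := R[i].

(** Whatever K is, K i contains the vectors v f(A) with f of degree at most i.  The
    choice of K is left open because two properties of such vectors are needed:
    their support and their orthogonality to a given invariant subspace. *)
Definition krylov_chain d (A : 'M[C]_d) (v : 'rV[C]_d) (K : nat -> 'M[C]_d) :=
  [/\ (v <= K 0)%MS, forall i, (K i <= K i.+1)%MS
    & forall i, (K i *m A <= K i.+1)%MS].

(** This is 0 <= A <= 1 as quadratic forms. *)
Definition contraction_form d (A : 'M[C]_d) :=
  forall u : 'rV[C]_d, 0 <= (u *m A *m u^t*) 0 0 <= nrm2 u.

(** The spectral theorem turns v into a function on the spectrum of A with values
    c, hence into the measure with weights |c i| ^ 2.  The range of p is spanned
    by the images of v under the Bernstein pieces of [almost_eigen_pieces]; it
    contains v because the pieces add up to 1. *)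
Lemma hproj_containing_vector (delta : R) : 0 < delta -> exists N : nat,
  forall d (A : 'M[C]_d) (v : 'rV[C]_d), A^t* = A -> contraction_form A ->
  exists p : 'M[C]_d, [/\ hproj p, v *m p = v,
    forall x : 'rV[C]_d,
      nrm2 (x *m p *m A *m (1%:M - p)) <= delta%:C * nrm2 (x *m p)
  & forall K, krylov_chain A v K -> (p <= K N)%MS].
Proof.
move=> d0; have [N [m Nm]] := almost_eigen_pieces d0; exists N => d A v Ah A01.
have [U [s [UU UU' AE sreal]]] := spectral_hermitian Ah.
pose x i := complex.Re (s 0 i).
have xE i : s 0 i = (x i)%:C by rewrite /x RRe_real.
have [c cU] : exists c, c *m U = v.
  by exists (v *m U^t*); rewrite -mulmxA UU' mulmx1.
pose w i := Normc.normc (c 0 i) ^+ 2.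
have wE i : `|c 0 i| ^+ 2 = (w i)%:C.
  by rewrite /w rmorphXn.
have w_ge0 i : 0 <= w i by rewrite sqr_ge0.
have x01 i : 0 <= x i <= 1.
  have UA : U *m A = diag_mx s *m U by rewrite AE !mulmxA UU mul1mx.
  have := A01 (row i U); rewrite -[row i U *m A]row_mul UA.
  have -> : (row i (diag_mx s *m U) *m (row i U)^t*) 0 0 = s 0 i.
    rewrite mul_diag_mx -[RHS]mulr1.
    have /matrixP/(_ i i) := UU; rewrite !mxE eqxx mulr1n => <-.
    by rewrite mulr_sumr; apply: eq_bigr => j _; rewrite !mxE mulrA.
  have -> : nrm2 (row i U) = 1.
    have /matrixP/(_ i i) := UU; rewrite !mxE eqxx mulr1n => <-.
    by rewrite /nrm2 mxE; apply: eq_bigr => j _; rewrite !mxE.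
  by rewrite xE !lecR.
have [G [t Gt]] := Nm d w x w_ge0 x01.
(* vec f is v f(A). *)
pose vec (f : R -> C) : 'rV[C]_d := (\row_i (c 0 i * f (x i))) *m U.
have vecA f : vec f *m A = vec (fun y => y%:C * f y).
  rewrite /vec {1}AE !mulmxA -(mulmxA _ U) UU mulmx1; congr (_ *m _).
  by apply/rowP => i; rewrite mul_mx_diag !mxE xE; ring.
have vecD f g : vec (fun y => f y + g y) = vec f + vec g.
  by rewrite -mulmxDl; congr (_ *m _); apply/rowP => i; rewrite !mxE mulrDr.
have vecZ a f : vec (fun y => a * f y) = a *: vec f.
  by rewrite /vec scalemxAl; congr (_ *m _); apply/rowP => i; rewrite !mxE mulrCA.
have vec_sum (I : finType) (P : pred I) (f : I -> R -> C) :
    vec (fun y => \sum_(i | P i) f i y) = \sum_(i | P i) vec (f i).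
  rewrite /vec -mulmx_suml; congr (_ *m _); apply/rowP => i.
  by rewrite mxE mulr_sumr summxE; apply: eq_bigr => j _; rewrite mxE.
have vec_eq f g : f =1 g -> vec f = vec g.
  by move=> fg; congr (_ *m _); apply/rowP => i; rewrite !mxE fg.
have vec1 : vec (fun=> 1) = v.
  by rewrite -[RHS]cU; congr (_ *m _); apply/rowP => i; rewrite !mxE mulr1.
(* The pieces are real functions, so that real and imaginary parts of the
   coefficients contribute separately. *)
have vec_nrm (b : 'I_m -> C) (h : 'I_m -> R -> R) :
    nrm2 (vec (fun y => \sum_g b g * (h g y)%:C)) =
    (expect w x (fun y => (\sum_g complex.Re (b g) * h g y) ^+ 2)
     + expect w x (fun y => (\sum_g complex.Im (b g) * h g y) ^+ 2))%:C.
  rewrite /vec nrm2_unitary// nrm2E -expectD rmorph_sum; apply: eq_bigr => i _ /=.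
  rewrite mxE normrM exprMn wE [in RHS]rmorphM /=; congr (_ * _).
  rewrite -add_Re2_Im2 !raddf_sum /=; congr ((_ ^+ 2 + _ ^+ 2)%:C);
    by apply: eq_bigr => g _; case: (b g) => ? ? /=; ring.
pose bv g y := bern_part G g y : R.
pose X : 'M[C]_(m, d) := \matrix_(g < m) vec (fun y => (bv g y)%:C).
have [p [hp Xp pX]] := hproj_rowspace X.
have mulX (b : 'rV[C]_m) : b *m X = vec (fun y => \sum_g b 0 g * (bv g y)%:C).
  rewrite mulmx_sum_row vec_sum; apply: eq_bigr => g _.
  by rewrite rowK vecZ.
exists p; split => //.
- have -> : v = (const_mx 1) *m X.
    rewrite mulX -vec1; apply: vec_eq => y.
    rewrite -[LHS](rmorph1 (real_complex R)) -(bern_sum N y) (partition_big G xpredT)//=.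
    by rewrite rmorph_sum; apply: eq_bigr => g _; rewrite mxE mul1r.
  by rewrite -mulmxA Xp.
- move=> u; have /submxP[b bE] : (u *m p <= X)%MS by rewrite (submx_trans _ pX)// submxMl.
  (* u p is a combination of pieces with coefficients b; multiplying the
     coefficient of each piece by its point t g gives an element of the range of
     p, which 1 - p kills. *)
  rewrite bE; pose b' := \row_g (b 0 g * (t g)%:C) : 'rV[C]_m.
  have -> : b *m X *m A *m (1%:M - p) = (b *m X *m A - b' *m X) *m (1%:M - p).
    have X0 : X *m (1%:M - p) = 0 by rewrite mulmxBr mulmx1 Xp subrr.
    by rewrite [in RHS]mulmxBl -[b' *m X *m _]mulmxA X0 mulmx0 subr0.
  apply: (le_trans (nrm2_hproj_le _ (hprojC hp))).
  have -> : b *m X *m A - b' *m X =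
      vec (fun y => \sum_g b 0 g * ((y - t g) * bv g y)%:C).
    rewrite !mulX vecA -scaleN1r -vecZ -vecD; apply: vec_eq => y.
    rewrite !mulr_sumr -big_split; apply: eq_bigr => g _.
    by rewrite mxE rmorphM rmorphB /=; ring.
  rewrite mulX !vec_nrm -rmorphM lecR mulrDr.
  have ass (a : 'I_m -> R) : expect w x (fun y => (\sum_g a g * ((y - t g) * bv g y)) ^+ 2)
     <= delta * expect w x (fun y => (\sum_g a g * bv g y) ^+ 2).
    apply: le_trans (Gt a); rewrite le_eqVlt; apply/orP; left; apply/eqP.
    by apply: eq_bigr => i _; congr (_ * _ ^+ 2); apply: eq_bigr => g _; rewrite mulrA.
  by apply: lerD; exact: ass.
- move=> K [vK0 KS KA]; apply: (submx_trans pX); apply/row_subP => g; rewrite rowK.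
  have pow1 j : (vec (fun y => (y ^+ j)%:C) <= K j)%MS.
    elim: j => [|j IH]; first by rewrite (vec_eq _ (fun=> 1)) ?vec1// => y; rewrite expr0.
    rewrite (vec_eq _ (fun y => y%:C * (y ^+ j)%:C)).
      by rewrite -vecA (submx_trans _ (KA j))// submxMr.
    by move=> y; rewrite exprS rmorphM.
  have pow2 j k : (vec (fun y => (y ^+ j * (1 - y) ^+ k)%:C) <= K (j + k)%N)%MS.
    elim: k => [|k IH].
      by rewrite addn0 (vec_eq _ (fun y => (y ^+ j)%:C))// => y; rewrite expr0 mulr1.
    rewrite addnS (vec_eq _ (fun y => (y ^+ j * (1 - y) ^+ k)%:C
        + (-1) * (y%:C * (y ^+ j * (1 - y) ^+ k)%:C))).
      rewrite vecD vecZ -vecA scaleN1r addmx_sub//; first exact: submx_trans IH (KS _).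
      by rewrite eqmx_opp (submx_trans _ (KA _))// submxMr.
    by move=> y; rewrite exprS !rmorphM rmorphB rmorph1 /=; ring.
  rewrite (vec_eq _ (fun y => \sum_(j < N.+1 | G j == g) (bern N j y)%:C)).
    rewrite vec_sum summx_sub// => j _.
    rewrite (vec_eq _ (fun y => ('C(N, j)%:R : C) * (y ^+ j * (1 - y) ^+ (N - j))%:C)).
      rewrite vecZ scalemx_sub//; have := pow2 j (N - j)%N.
      by rewrite subnKC// -ltnS ltn_ord.
    by move=> y; rewrite rmorphM rmorph_nat.
  by move=> y; rewrite rmorph_sum.
Qed.

End OneVector.

(** * Almost invariant projections of band matrices *)

Section FirstCoordinates.
Context {F : fieldType}.

Lemma submx_pid m d s (X : 'M[F]_(m, d)) :
  (forall i (a : 'I_d), (s <= a)%N -> X i a = 0) -> (X <= (pid_mx s : 'M[F]_d))%MS.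
Proof.
move=> X0; apply/submxP; exists X; apply/matrixP => i a; rewrite mxE.
rewrite (bigD1 a) //= big1 ?addr0 => [|b ba]; rewrite mxE.
  by rewrite eqxx /=; have [_|/X0 ->] := ltnP; rewrite ?mulr1 ?mul0r.
by rewrite (inj_eq val_inj) (negPf ba) mulr0.
Qed.

Lemma submx_pidP m d s (X : 'M[F]_(m, d)) : (X <= (pid_mx s : 'M[F]_d))%MS ->
  forall i (a : 'I_d), (s <= a)%N -> X i a = 0.
Proof.
case/submxP => D -> i a sa; rewrite mxE big1// => b _; rewrite mxE.
case: eqP => [->|_]; last by rewrite mulr0.
by rewrite ltnNge sa mulr0.
Qed.

Lemma pid_mx_subS d s t : (s <= t)%N ->
  ((pid_mx s : 'M[F]_d) <= (pid_mx t : 'M[F]_d))%MS.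
Proof.
move=> st; apply: submx_pid => i a ta.
exact: submx_pidP (submx_refl _) i a (leq_trans st ta).
Qed.

Lemma pid_mx_band d s w (A : 'M[F]_d) :
  (forall i j : 'I_d, (i + w < j)%N -> A i j = 0) ->
  ((pid_mx s : 'M[F]_d) *m A <= (pid_mx (s + w) : 'M[F]_d))%MS.
Proof.
move=> Aw; apply: submx_pid => i a sa; rewrite mxE big1// => b _; rewrite mxE.
have [bs|_] := ltnP i s; last by rewrite andbF mul0r.
rewrite andbT; case: (val i =P val b) => [ib|_]; last by rewrite mul0r.
by rewrite Aw ?mulr0//; move: ib bs sa => /=; lia.
Qed.

End FirstCoordinates.

Section Compression.
Context {R : realType}.
Local Open Scope complex_scope.
Local Notation C := R[i].

Definition band_above d w (A : 'M[C]_d) :=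
  forall i j : 'I_d, (i + w < j)%N -> A i j = 0.

(** Induction on k: given p1 for the first k coordinates, the residual part v of
    the next coordinate vector is treated in the orthogonal complement of the
    range of p1, with A replaced by its compression A' to this complement.  The
    new projection p2 is orthogonal to p1, and the errors of p1 and p2 add up.
    The support of the result is controlled because A moves supports by w. *)
Lemma hproj_containing_first_coordinates (k w : nat) (delta : R) : 0 < delta -> exists N : nat,
  forall d (A : 'M[C]_d), A^t* = A -> contraction_form A -> band_above w A ->
  exists p : 'M[C]_d, [/\ hproj p,
    forall i : 'I_d, (i < k)%N -> delta_mx 0 i *m p = delta_mx 0 i :> 'rV[C]_d,
    (p <= (pid_mx N : 'M[C]_d))%MS
  & forall x : 'rV[C]_d,
      nrm2 (x *m p *m A *m (1%:M - p)) <= delta%:C * nrm2 (x *m p)].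
Proof.
elim: k delta => [|k IH] delta d0.
  exists 0%N => d A _ _ _; exists 0; split=> //; first exact: hproj0.
    exact: sub0mx.
  by move=> x; rewrite mulmx0 !mul0mx /nrm2 !mul0mx mxE mulr0.
have d4 : 0 < delta / 4 by rewrite divr_gt0.
have d4C : 0 <= (delta / 4)%:C by rewrite lecR ltW.
have [N1 N1P] := IH _ d4; have [N2 N2P] := hproj_containing_vector d4.
exists (N1 + k.+1 + N2 * w)%N => d A Ah A01 Aw.
have [p1 [hp1 p1k p1N p1A]] := N1P d A Ah A01 Aw.
have p1N' : (p1 <= (pid_mx (N1 + k.+1 + N2 * w) : 'M[C]_d))%MS.
  by apply: submx_trans p1N (pid_mx_subS _ _); rewrite -addnA leq_addr.
have [dk|kd] := leqP d k.
  exists p1; split=> // [i _|x].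
    by apply: p1k; apply: leq_trans (ltn_ord i) dk.
  apply: (le_trans (p1A x)); rewrite ler_wpM2r ?nrm2_ge0// lecR.
  by rewrite ler_pdivrMr//; move: d0; lra.
pose q1 := 1%:M - p1; have hq1 : hproj q1 := hprojC hp1.
have [p1h p1p1] := hp1; have [q1h q1q1] := hq1.
have q1p1 : q1 *m p1 = 0 by rewrite mulmxBl mul1mx p1p1 subrr.
pose A' := q1 *m A *m q1; pose e : 'rV[C]_d := delta_mx 0 (Ordinal kd).
pose v := e *m q1.
have A'h : A'^t* = A' by rewrite !trmxCM q1h Ah mulmxA.
have A'01 : contraction_form A'.
  move=> u; have /andP[h1 h2] := A01 (u *m q1).
  have -> : u *m A' *m u^t* = u *m q1 *m A *m (u *m q1)^t*.
    by rewrite trmxCM q1h !mulmxA.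
  by apply/andP; split; [exact: h1 | exact: le_trans h2 (nrm2_hproj_le _ hq1)].
have [p2 [hp2 vp2 p2A p2K]] := N2P d A' v A'h A'01.
(* The complement of the range of p1 is invariant under A' and contains v. *)
have p2p1 : p2 *m p1 = 0.
  apply/sub_kermxP; apply: (p2K (fun=> kermx p1)); split=> // [|i].
    by apply/sub_kermxP; rewrite /v -mulmxA q1p1 mulmx0.
  by apply/sub_kermxP; rewrite /A' -!mulmxA q1p1 !mulmx0.
have [hP p1p2] := hprojD hp2 hp1 p2p1; rewrite addrC in hP.
have q1sub s m (X : 'M[C]_(m, d)) : (N1 <= s)%N -> (X <= (pid_mx s : 'M[C]_d))%MS ->
    (X *m q1 <= (pid_mx s : 'M[C]_d))%MS.
  move=> sN XN; rewrite mulmxBr mulmx1 addmx_sub// eqmx_opp.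
  apply: (submx_trans (submxMl _ _)); apply: (submx_trans p1N).
  exact: pid_mx_subS.
have p2N : (p2 <= (pid_mx (N1 + k.+1 + N2 * w) : 'M[C]_d))%MS.
  apply: (p2K (fun i => pid_mx (N1 + k.+1 + i * w))); split=> [|i|i].
  - rewrite /v q1sub//; first by rewrite mul0n addn0 leq_addr.
    apply: submx_pid => i a; rewrite mul0n addn0 => ka; rewrite mxE.
    by case: (a =P _) => [aE|_]; rewrite ?andbF//; move: ka; rewrite aE /=; lia.
  - by apply: pid_mx_subS; rewrite leq_add2l leq_mul2r leqnSn orbT.
  - rewrite /A' mulmxA q1sub//; first by rewrite -addnA leq_addr.
    rewrite mulmxA (submx_trans (submxMr A (q1sub (N1 + k.+1 + i * w)%N _ _ _ (submx_refl _))))//.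
      by rewrite -addnA leq_addr.
    by rewrite mulSnr addnA pid_mx_band.
exists (p1 + p2); split; first exact: hP.
- move=> i; rewrite ltnS leq_eqVlt => /orP[/eqP ik|ik]; last first.
    have eip := p1k i ik; rewrite mulmxDr eip -[in X in _ + X]eip -mulmxA p1p2.
    by rewrite mulmx0 addr0.
  have -> : delta_mx 0 i = e by congr delta_mx; apply: val_inj.
  have eE : e = e *m p1 + v by rewrite /v mulmxBr mulmx1 addrC subrK.
  have ep2 : e *m p2 = v by rewrite eE mulmxDl -mulmxA p1p2 mulmx0 add0r vp2.
  by rewrite mulmxDr ep2 -eE.
- by apply: addmx_sub; [exact: p1N' | exact: p2N].
move=> x.
have QE : 1%:M - (p1 + p2) = q1 *m (1%:M - p2).
  by rewrite mulmxBr mulmx1 /q1 mulmxBl mul1mx p1p2 subr0 opprD addrA.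
have xP1 : x *m p1 = x *m (p1 + p2) *m p1 by rewrite -mulmxA mulmxDl p1p1 p2p1 addr0.
have xP2 : x *m p2 = x *m (p1 + p2) *m p2.
  by rewrite -mulmxA mulmxDl p1p2 add0r; case: hp2 => _ ->.
have b1 : nrm2 (x *m p1 *m A *m (1%:M - (p1 + p2))) <= (delta / 4)%:C * nrm2 (x *m (p1 + p2)).
  rewrite QE mulmxA; apply: (le_trans (nrm2_hproj_le _ (hprojC hp2))).
  apply: (le_trans (p1A x)); apply: ler_wpM2l => //.
  by rewrite xP1; exact: nrm2_hproj_le.
have b2 : nrm2 (x *m p2 *m A *m (1%:M - (p1 + p2))) <= (delta / 4)%:C * nrm2 (x *m (p1 + p2)).
  have -> : x *m p2 *m A *m (1%:M - (p1 + p2)) = x *m p2 *m A' *m (1%:M - p2).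
    have p2q1 : p2 *m q1 = p2 by rewrite mulmxBr mulmx1 p2p1 subr0.
    by rewrite QE /A' !mulmxA -(mulmxA x p2 q1) p2q1.
  apply: (le_trans (p2A x)); apply: ler_wpM2l => //.
  by rewrite xP2; exact: nrm2_hproj_le.
have -> : x *m (p1 + p2) *m A *m (1%:M - (p1 + p2)) =
    x *m p1 *m A *m (1%:M - (p1 + p2)) + x *m p2 *m A *m (1%:M - (p1 + p2)).
  by rewrite (mulmxDr x p1 p2) !mulmxDl.
apply: (le_trans (nrm2D_le _ _)).
have -> : delta%:C * nrm2 (x *m (p1 + p2)) =
    2 * ((delta / 4)%:C * nrm2 (x *m (p1 + p2))) + 2 * ((delta / 4)%:C * nrm2 (x *m (p1 + p2))).
  have dE : delta%:C = 2 * (delta / 4)%:C + 2 * (delta / 4)%:C.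
    rewrite -(rmorph_nat (real_complex R) 2) -rmorphM -rmorphD.
    by congr (_%:C); field.
  by rewrite dE mulrDl !mulrA.
apply: lerD; first exact (ler_wpM2l (ler0n _ 2) b1).
exact (ler_wpM2l (ler0n _ 2) b2).
Qed.

End Compression.

Section CrossTerms.
Context {C : numClosedFieldType}.

Lemma trmxCZ m n (a : C) (A : 'M[C]_(m, n)) : 0 <= a -> (a *: A)^t* = a *: A^t*.
Proof. by move=> a0; rewrite linearZ /= map_mxZ /= conj_Creal// ger0_real. Qed.

Lemma nrm2Z d (a : C) (u : 'rV[C]_d) : 0 <= a -> nrm2 (a *: u) = a ^+ 2 * nrm2 u.
Proof. by move=> a0; rewrite /nrm2 trmxCZ// -scalemxAl -scalemxAr !mxE mulrA. Qed.

(** Cauchy-Schwarz for twice the real part of the product of y and z, obtained from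
    the positivity of the norms of e y + z and e y - z. *)
Lemma cross_le d (e : C) (y z : 'rV[C]_d) : 0 < e -> nrm2 z <= e ^+ 2 * nrm2 y ->
  - (2 * e * nrm2 y) <= (z *m y^t* + y *m z^t*) 0 0 <= 2 * e * nrm2 y.
Proof.
move=> e0 zy; have e0' := ltW e0; set X := (z *m _ + _) 0 0.
have sq (s : C) : s = 1 \/ s = -1 -> 0 <= e ^+ 2 * nrm2 y + s * (e * X) + nrm2 z.
  move=> s1; have := nrm2_ge0 (e *: y + s *: z); congr (_ <= _).
  have sC : (s *: z)^t* = s *: z^t*.
    by case: s1 => ->; rewrite ?scale1r ?scaleN1r// linearN map_mxN.
  have ss : s * s = 1 by case: s1 => ->; rewrite ?mulrNN mulr1.
  rewrite /X /nrm2 trmxCD sC trmxCZ// !mulmxDl !mulmxDr.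
  rewrite -!scalemxAl -!scalemxAr !scalerA ss !mxE; ring.
have le s : s = 1 \/ s = -1 -> - (s * X) <= 2 * e * nrm2 y.
  move=> /sq h; rewrite -(ler_pM2l e0) -subr_ge0; apply: (le_trans h).
  rewrite -subr_ge0; have := zy; rewrite -subr_ge0 => h2; apply: (le_trans h2).
  by rewrite le_eqVlt; apply/orP; left; apply/eqP; ring.
apply/andP; split.
  by rewrite lerNl; have := le 1 (or_introl erefl); rewrite mul1r.
by have := le (-1) (or_intror erefl); rewrite mulN1r opprK.
Qed.

Lemma card_near d w (i : 'I_d) :
  (#|[pred k : 'I_d | (i <= k + w) && (k <= i + w)]| <= (w + w).+1)%N.
Proof.
set A := [pred _ | _]; pose f (k : 'I_d) : 'I_(w + w).+1 := inord (k + w - i).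
have fi : {in A &, injective f}.
  move=> k l; rewrite !inE => /andP[k1 k2] /andP[l1 l2] /(congr1 val) /=.
  by rewrite !inordK; [|lia|lia] => kl; apply: val_inj => /=; lia.
by rewrite -(card_in_imset fi) -[X in (_ <= X)%N]card_ord max_card.
Qed.

(** Schur's test.  The bound does not depend on the size of the matrix. *)
Lemma schur_bound d w (M : C) (h : 'M[C]_d) (u : 'rV[C]_d) : h^t* = h ->
  (forall i k, `|h i k| <= M) ->
  (forall i k : 'I_d, ~~ ((i <= k + w) && (k <= i + w))%N -> h i k = 0) ->
  - (M * (w + w).+1%:R * nrm2 u) <= (u *m h *m u^t*) 0 0
    <= M * (w + w).+1%:R * nrm2 u.
Proof.
move=> hh hM hw; set z := (_ *m u^t*) 0 0.
have zr : z \is Num.real.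
  apply/CrealP; have : (u *m h *m u^t*)^t* = u *m h *m u^t*.
    by rewrite !trmxCM trmxCK hh mulmxA.
  by move/matrixP/(_ 0 0); rewrite mxE [X in X^*]mxE.
rewrite -real_ler_norml//.
pose near (i k : 'I_d) := (i <= k + w)%N && (k <= i + w)%N.
have M0 i k : 0 <= (if near i k then M else 0).
  by case: ifP => // _; apply: le_trans (hM i k).
pose m (i k : 'I_d) := if near i k then M else 0.
have hm i k : `|h i k| <= m i k.
  by rewrite /m; case: ifPn => // ik; rewrite hw// normr0.
have zE : z = \sum_i \sum_k u 0 i * h i k * (u 0 k)^*.
  rewrite /z mxE exchange_big; apply: eq_bigr => k _ /=.
  by rewrite mxE mulr_suml; apply: eq_bigr => i _; rewrite !mxE.
have half i k : `|u 0 i * h i k * (u 0 k)^*| <=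
    2^-1 * (`|u 0 i| ^+ 2 * m i k) + 2^-1 * (`|u 0 k| ^+ 2 * m i k).
  rewrite !normrM norm_conjC mulrAC.
  apply: (@le_trans _ _ (`|u 0 i| * `|u 0 k| * m i k)).
    by rewrite ler_wpM2l ?mulr_ge0.
  rewrite -mulrDr -mulrDl mulrA ler_wpM2r//; first exact: M0.
  rewrite -subr_ge0 (_ : _ - _ = 2^-1 * (`|u 0 i| - `|u 0 k|) ^+ 2); last by field.
  by rewrite mulr_ge0 ?invr_ge0// real_exprn_even_ge0// realB.
have row i : \sum_k m i k <= M * (w + w).+1%:R.
  have Mge : 0 <= M by apply: le_trans (hM i i).
  rewrite -big_mkcond sumr_const -(mulr_natr M) ler_wpM2l// ler_nat.
  exact: card_near.
have mC i k : m i k = m k i by rewrite /m /near andbC.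
rewrite zE; apply: (le_trans (ler_norm_sum _ _ _)).
apply: (@le_trans _ _ (\sum_i \sum_k
    (2^-1 * (`|u 0 i| ^+ 2 * m i k) + 2^-1 * (`|u 0 k| ^+ 2 * m i k)))).
  apply: ler_sum => i _; apply: (le_trans (ler_norm_sum _ _ _)).
  by apply: ler_sum => k _; exact: half.
under eq_bigr do rewrite big_split; rewrite big_split /= [X in _ + X]exchange_big /=.
under [X in _ + X]eq_bigr => k _ do under eq_bigr => i _ do rewrite mC.
rewrite -big_split /= nrm2E mulr_sumr; apply: ler_sum => i _.
rewrite -!mulr_sumr -mulrDl (_ : 2^-1 + 2^-1 = 1) ?mul1r; last by field.
by rewrite mulrC; apply: ler_wpM2r; rewrite ?exprn_ge0.
Qed.

End CrossTerms.

Section AlmostInvariantBasis.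
Context {R : realType}.
Local Open Scope complex_scope.
Local Notation C := R[i].

(** The rows of U are an orthonormal basis adapted to a projection p: those of type
    true span the range of p and vanish from N on; those of type false span its
    complement and vanish before w.  The matrix O consists of the entries of h
    in this basis between the two types. *)
Definition adapted (N w : nat) (eps : R) d (h U : 'M[C]_d) (ty : 'I_d -> bool) : Prop :=
  [/\ U *m U^t* = 1%:M, U^t* *m U = 1%:M,
      forall i (a : 'I_d), ty i -> (N <= a)%N -> U i a = 0,
      forall i (a : 'I_d), ~~ ty i -> (a < w)%N -> U i a = 0
    & forall u : 'rV[C]_d, let O := \matrix_(i, j)
        if ty i == ty j then 0 else (U *m h *m U^t*) i j in
      - (eps%:C * nrm2 u) <= (u *m O *m u^t*) 0 0 <= eps%:C * nrm2 u].

(** The basis diagonalizes the projection p of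
    [hproj_containing_first_coordinates] applied to an affine image A of h with
    0 <= A <= 1.  Since p fixes the first w coordinate vectors, the rows in the
    kernel of p vanish there. *)
Lemma almost_invariant_basis (w : nat) (K eps : R) : 0 < K -> 0 < eps ->
  exists N : nat, forall d (h : 'M[C]_d), h^t* = h ->
  (forall u : 'rV[C]_d, - (K%:C * nrm2 u) <= (u *m h *m u^t*) 0 0 <= K%:C * nrm2 u) ->
  band_above w h -> exists U ty, adapted N w eps h U ty.
Proof.
(* h = 2 K A - K, hence (1 - p) h p is at most 2 K times (1 - p) A p, of
   square norm at most 4 K ^ 2 delta = (eps / 2) ^ 2; the factor 2 is for the two
   off-diagonal corners of O. *)
move=> K0 e0; pose delta := eps ^+ 2 / (16 * K ^+ 2).
have d0 : 0 < delta by rewrite divr_gt0 ?exprn_gt0// mulr_gt0 ?exprn_gt0.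
have [N NP] := hproj_containing_first_coordinates w w d0; exists N => d h hh hK hw.
have two : 2 = (2%:R : R)%:C by rewrite rmorph_nat.
pose k := ((2 * K)^-1)%:C; have k0 : 0 <= k by rewrite lecR invr_ge0 mulr_ge0// ltW.
have KC0 : 0 <= K%:C by rewrite lecR ltW.
have kK : k * (2 * K%:C) = 1.
  rewrite two -!rmorphM -[RHS](rmorph1 (real_complex R)); congr (_%:C).
  by field; rewrite gt_eqF.
pose A := k *: (h + K%:C *: 1%:M).
have Ah : A^t* = A by rewrite (trmxCZ _ k0) trmxCD hh (trmxCZ _ KC0) trmxC1.
have formA u : (u *m A *m u^t*) 0 0 = k * ((u *m h *m u^t*) 0 0 + K%:C * nrm2 u).
  rewrite /A -scalemxAr -scalemxAl mulmxDr mulmxDl -scalemxAr -scalemxAl mulmx1.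
  by rewrite [LHS]mxE; congr (_ * _); rewrite [LHS]mxE; congr (_ + _); rewrite [LHS]mxE.
have A01 : contraction_form A.
  move=> u; have /andP[h1 h2] := hK u; rewrite formA; apply/andP; split.
    by apply: mulr_ge0 => //; rewrite -lerBlDr sub0r.
  rewrite -[leRHS]mul1r -kK -mulrA; apply: ler_wpM2l => //.
  by rewrite -mulrA mulrDl mul1r lerD2r.
have Aw : band_above w A.
  move=> i j ij; rewrite !mxE hw// add0r; case: (i =P j) => [E|_].
    by move: ij; rewrite E ltnNge leq_addr.
  by rewrite mulr0n !mulr0.
have [p [hp pw pN pA]] := NP d A Ah A01 Aw; have [ph pp] := hp.
have [U [s [UU UU' pE sreal]]] := spectral_hermitian ph.
have Up : U *m p = diag_mx s *m U by rewrite pE !mulmxA UU mul1mx.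
have ss i : s 0 i * s 0 i = s 0 i.
  have : diag_mx s *m diag_mx s = diag_mx s.
    rewrite -[in RHS](mulmx1 (diag_mx s)) -UU mulmxA -Up -pp mulmxA Up.
    by rewrite -[_ *m p]mulmxA Up !mulmxA -!mulmxA UU mulmx1.
  by move/matrixP/(_ i i); rewrite mulmx_diag !mxE eqxx !mulr1n.
have s01 i : s 0 i = (s 0 i == 1)%:R.
  have [->//|/eqP s1] := eqVneq (s 0 i) 1.
  have /eqP : s 0 i * (s 0 i - 1) = 0 by rewrite mulrBr mulr1 ss subrr.
  by rewrite mulf_eq0 subr_eq0 => /orP[/eqP|/eqP].
pose ty i := s 0 i == 1; exists U, ty; split=> //.
- move=> i a /eqP ti aN; have /matrixP/(_ i a) := Up.
  rewrite mul_diag_mx !mxE ti mul1r => <-.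
  by apply: big1 => b _; rewrite (submx_pidP pN)// mulr0.
- move=> i a ti aw; have /matrixP/(_ i a) := Up.
  rewrite mul_diag_mx [in RHS]mxE s01 -/(ty i) (negPf ti) mul0r => <-.
  have pa b : p b a = (b == a)%:R.
    have /rowP/(_ b) := pw a aw; rewrite -rowE !mxE /= => pab.
    have /matrixP/(_ b a) := ph; rewrite !mxE pab => <-; rewrite conjC_nat.
    by [].
  rewrite mxE (bigD1 a) //= big1 => [|b ba]; rewrite pa ?eqxx ?mulr1 ?addr0//.
  by rewrite (negPf ba) mulr0.
move=> u; cbv zeta; set O := (X in u *m X *m _); pose y := u *m U; pose z := y *m p *m h *m (1%:M - p).
have OE : O = diag_mx s *m (U *m h *m U^t*) *m (1%:M - diag_mx s)
    + (1%:M - diag_mx s) *m (U *m h *m U^t*) *m diag_mx s.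
  have -> : 1%:M - diag_mx s = diag_mx (const_mx 1 - s).
    by rewrite linearB /= diag_const_mx.
  rewrite /O; move: (U *m h *m U^t*) => H; apply/matrixP => i j.
  rewrite !mul_mx_diag !mul_diag_mx !mxE (s01 i) (s01 j) /ty.
  by case: (s 0 i == 1); case: (s 0 j == 1); rewrite /=; ring.
have sC : (diag_mx s)^t* = diag_mx s.
  have -> : diag_mx s = U *m p *m U^t* by rewrite Up -mulmxA UU mulmx1.
  by rewrite !trmxCM trmxCK ph mulmxA.
have uD : u *m diag_mx s = y *m p *m U^t*.
  by rewrite /y -[u *m U *m p]mulmxA Up !mulmxA -mulmxA UU mulmx1.
have Du : (1%:M - diag_mx s) *m u^t* = U *m (1%:M - p) *m y^t*.
  rewrite /y trmxCM mulmxBr mulmx1 !mulmxA mulmxBl mulmxBl UU Up.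
  by rewrite mul1mx -[_ *m U *m _]mulmxA UU mulmx1 mulmxBl mul1mx.
have uO : u *m O *m u^t* = z *m y^t* + y *m z^t*.
  have e1 : u *m (diag_mx s *m (U *m h *m U^t*) *m (1%:M - diag_mx s)) *m u^t* = z *m y^t*.
    rewrite !mulmxA uD -[_ *m (1%:M - _) *m _]mulmxA Du /z !mulmxA.
    by rewrite -[y *m p *m U^t* *m U]mulmxA UU' mulmx1 -[_ *m U^t* *m U]mulmxA UU' mulmx1.
  have uD2 E1 E2 : u *m (E1 + E2) *m u^t* = u *m E1 *m u^t* + u *m E2 *m u^t*.
    by rewrite mulmxDr mulmxDl.
  rewrite OE uD2 e1; congr (_ + _).
  have -> : y *m z^t* = (z *m y^t*)^t* by rewrite [RHS]trmxCM trmxCK.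
  by rewrite -e1 !trmxCM !trmxCK trmxCB trmxC1 sC hh !mulmxA.
rewrite uO.
have yu : nrm2 y = nrm2 u by rewrite nrm2_unitary.
have hE : h = (2 * K%:C) *: A - K%:C *: 1%:M.
  by rewrite /A scalerA mulrC kK scale1r addrK.
have zE : z = (2 * K%:C) *: (y *m p *m A *m (1%:M - p)).
  have p0 : y *m p *m (1%:M - p) = 0.
    by rewrite mulmxBr mulmx1 -[y *m p *m p]mulmxA pp subrr.
  rewrite /z {1}hE (mulmxBr (y *m p)) (mulmxBl _ _ (1%:M - p)).
  by rewrite -!scalemxAr -!scalemxAl mulmx1 p0 scaler0 subr0.
have epsE : eps%:C = 2 * (eps / 2)%:C.
  by rewrite two -rmorphM; congr (_%:C); field.
rewrite -yu epsE; apply: cross_le; first by rewrite ltcR divr_gt0.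
have K2 : 0 <= 2 * K%:C by rewrite mulr_ge0.
rewrite zE nrm2Z//.
apply: (@le_trans _ _ ((2 * K%:C) ^+ 2 * (delta%:C * nrm2 y))).
  apply: ler_wpM2l; first exact: exprn_ge0.
  apply: (le_trans (pA y)); apply: ler_wpM2l; first by rewrite lecR ltW.
  exact: nrm2_hproj_le.
rewrite mulrA le_eqVlt; apply/orP; left; apply/eqP; congr (_ * _).
rewrite two -rmorphM -!rmorphXn -rmorphM; congr (_%:C); rewrite /delta.
by field; rewrite gt_eqF.
Qed.

End AlmostInvariantBasis.

(** * Unconditional sums and the inner product of l^2 *)

Local Open Scope classical_set_scope.

Section Sums.
Context {R : realType} {X : choiceType}.
Implicit Types (f g : X -> R).

Definition total f : \bar R := (\esum_(x in [set: X]) (f x)%:E)%E.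

Definition abs_summable f : Prop := (total (fun x => `|f x|%R) < +oo)%E.

Lemma total_ge0 f : (forall x, 0 <= f x) -> (0 <= total f)%E.
Proof. by move=> f0; apply: esum_ge0 => x _; rewrite lee_fin. Qed.

Lemma totalD f g : (forall x, 0 <= f x) -> (forall x, 0 <= g x) ->
  total (fun x => f x + g x)%R = (total f + total g)%E.
Proof.
move=> f0 g0; rewrite /total -esumD//.
by move=> x _; rewrite lee_fin.
by move=> x _; rewrite lee_fin.
Qed.

Lemma total_mono f g : (forall x, f x <= g x) -> (total f <= total g)%E.
Proof. by move=> fg; apply: le_esum => x _; rewrite lee_fin. Qed.

Lemma totalZ_le (c : R) f : 0 <= c -> (forall x, 0 <= f x) ->
  (total (fun x => c * f x)%R <= c%:E * total f)%E.
Proof.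
move=> c0 f0; rewrite /total.
under eq_esum do rewrite EFinM.
by apply: esumZ_le => // x; rewrite lee_fin.
Qed.

Lemma abs_summable_le f g : (forall x, `|f x| <= g x) -> (total g < +oo)%E ->
  abs_summable f.
Proof. by move=> fg; apply: le_lt_trans; exact: total_mono. Qed.

Lemma total_fin_num f g : (forall x, 0 <= g x) -> (forall x, g x <= `|f x|) ->
  abs_summable f -> total g \is a fin_num.
Proof.
move=> g0 gf sf; rewrite ge0_fin_numE ?total_ge0//.
by apply: le_lt_trans sf; exact: total_mono.
Qed.

Lemma abs_summableD f g : abs_summable f -> abs_summable g ->
  abs_summable (fun x => f x + g x).
Proof.
move=> sf sg; apply: (@abs_summable_le _ (fun x => `|f x| + `|g x|)).
  by move=> x; exact: ler_normD.
by rewrite totalD// lte_add_pinfty.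
Qed.

Lemma abs_summableN f : abs_summable f -> abs_summable (fun x => - f x).
Proof. by apply: abs_summable_le => x; rewrite normrN. Qed.

Lemma rsumN f : rsum (fun x => - f x) = - rsum f.
Proof.
rewrite /rsum opprB; congr (_ - fine _).
by apply: eq_esum => x _; rewrite opprK.
Qed.

(** rsum is a difference of sums of positive and negative parts; additivity is the
    additivity of sums of nonnegative families, applied to
    (f + g)^+ + f^- + g^- = (f + g)^- + f^+ + g^+. *)
Lemma rsumD f g : abs_summable f -> abs_summable g ->
  rsum (fun x => f x + g x) = rsum f + rsum g.
Proof.
move=> sf sg; have sfg := abs_summableD sf sg.
have fpos h : abs_summable h -> total (fun x => Num.max (h x) 0) \is a fin_num.
  move=> sh; apply: total_fin_num sh => x; first by rewrite le_max lexx orbT.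
  by rewrite ge_max ler_norm normr_ge0.
have fneg h : abs_summable h -> total (fun x => Num.max (- h x) 0) \is a fin_num.
  by move=> /abs_summableN; exact: fpos.
pose p h (x : X) : R := Num.max (h x) 0; pose n h (x : X) : R := Num.max (- h x) 0.
have p0 h x : 0 <= p h x by rewrite /p le_max lexx orbT.
have n0 h x : 0 <= n h x by rewrite /n le_max lexx orbT.
pose fg x := f x + g x.
have : total (fun x => p fg x + (n f x + n g x)) =
    total (fun x => n fg x + (p f x + p g x)).
  apply: eq_esum => x _; congr (_%:E); rewrite /p /n /fg.
  have sub (r : R) : Num.max r 0 = r + Num.max (- r) 0.
    by rewrite !maxEle; case: ifPn; case: ifPn; rewrite -?ltNge; lra.
  by rewrite (sub (f x + g x)) (sub (f x)) (sub (g x)); ring.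
rewrite (totalD (p0 fg) (fun x => addr_ge0 (n0 f x) (n0 g x))) (totalD (n0 f) (n0 g)).
rewrite (totalD (n0 fg) (fun x => addr_ge0 (p0 f x) (p0 g x))) (totalD (p0 f) (p0 g)).
have [pf pg pfg] := And3 (fpos f sf) (fpos g sg) (fpos fg sfg).
have [nf ng nfg] := And3 (fneg f sf) (fneg g sg) (fneg fg sfg).
move/(congr1 fine); rewrite !fineD ?fin_numD ?pf ?pg ?pfg ?nf ?ng ?nfg// => E.
change (fine (total (p fg)) - fine (total (n fg)) =
  (fine (total (p f)) - fine (total (n f))) + (fine (total (p g)) - fine (total (n g)))).
by move: E; lra.
Qed.

Lemma rsum_eq f g : f =1 g -> rsum f = rsum g.
Proof. by move=> fg; congr rsum; apply/funext. Qed.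

Lemma rsum_ge0E f : (forall x, 0 <= f x) -> rsum f = fine (total f).
Proof.
move=> f0; rewrite /rsum [X in _ - fine X]esum1 => [|x _].
  by rewrite subr0; congr fine; apply: eq_esum => x _; rewrite max_l.
by rewrite max_r// oppr_le0.
Qed.

Lemma rsum_le f g : (forall x, f x <= g x) -> (forall x, 0 <= g x) ->
  (total g < +oo)%E -> rsum f <= fine (total g).
Proof.
move=> fg g0 sg; apply: (@le_trans _ _ (fine (total (fun x => Num.max (f x) 0)))).
  rewrite /rsum gerBl fine_ge0// total_ge0// => x.
  by rewrite le_max lexx orbT.
have gfin : total g \is a fin_num by rewrite ge0_fin_numE// total_ge0.
have le : (total (fun x => Num.max (f x) 0)%R <= total g)%E.
  by apply: total_mono => x; rewrite ge_max fg g0.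
apply: fine_le => //; rewrite ge0_fin_numE ?(le_lt_trans le)// total_ge0// => x.
by rewrite le_max lexx orbT.
Qed.

Lemma rsum_reindex (e e' : X -> X) f : cancel e e' -> cancel e' e ->
  rsum (f \o e) = rsum f.
Proof.
move=> ee' e'e; have be : set_bij [set: X] [set: X] e.
  split=> // [x y _ _ /(can_inj ee')//|x _].
  by exists (e' x).
rewrite /rsum.
by congr (fine _ - fine _); rewrite [RHS](@reindex_esum R _ _ _ _ e _ be).
Qed.

End Sums.

Section ComplexSums.
Context {R : realType} {X : choiceType}.
Local Notation C := R[i].
Implicit Types (f g : X -> C) (u v w : ell2 R X).

Lemma Re_le_normc (z : C) : `|complex.Re z| <= normc z.
Proof.
case: z => a b /=; rewrite -sqrtr_sqr ler_wsqrtr// lerDl sqr_ge0//.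
Qed.

Lemma Im_le_normc (z : C) : `|complex.Im z| <= normc z.
Proof.
case: z => a b /=; rewrite -sqrtr_sqr ler_wsqrtr// lerDr sqr_ge0//.
Qed.

Lemma normc_conjc (z : C) : normc (conjc z) = normc z.
Proof. by case: z => a b /=; rewrite sqrrN. Qed.

Definition csummable f : Prop :=
  abs_summable (fun x => complex.Re (f x)) /\ abs_summable (fun x => complex.Im (f x)).

Lemma csummable_le f (g : X -> R) : (forall x, normc (f x) <= g x) ->
  (total g < +oo)%E -> csummable f.
Proof.
move=> fg sg; split; apply: abs_summable_le sg => x; apply: le_trans (fg x).
  exact: Re_le_normc.
exact: Im_le_normc.
Qed.

Lemma csum_eq f g : f =1 g -> csum f = csum g.
Proof. by move=> fg; congr csum; apply/funext. Qed.

Lemma csummableD f g : csummable f -> csummable g -> csummable (fun x => f x + g x).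
Proof.
move=> [rf mf] [rg mg]; split.
  have := abs_summableD rf rg; congr abs_summable; apply/funext => x.
  by case: (f x) (g x) => ? ? [].
have := abs_summableD mf mg; congr abs_summable; apply/funext => x.
by case: (f x) (g x) => ? ? [].
Qed.

Lemma csumD f g : csummable f -> csummable g ->
  csum (fun x => f x + g x) = csum f + csum g.
Proof.
move=> [rf mf] [rg mg]; rewrite /csum.
rewrite (@rsum_eq _ _ _ (fun x => complex.Re (f x) + complex.Re (g x))); last first.
  by move=> x; case: (f x) (g x) => ? ? [].
rewrite (@rsum_eq _ _ (fun x => complex.Im (f x + g x))
  (fun x => complex.Im (f x) + complex.Im (g x))); last first.
  by move=> x; case: (f x) (g x) => ? ? [].
by rewrite (rsumD rf rg) (rsumD mf mg).
Qed.

Lemma csumN f : csum (fun x => - f x) = - csum f.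
Proof.
rewrite /csum (@rsum_eq _ _ _ (fun x => - complex.Re (f x))); last first.
  by move=> x; case: (f x).
rewrite (@rsum_eq _ _ (fun x => complex.Im (- f x)) (fun x => - complex.Im (f x))); last first.
  by move=> x; case: (f x).
by rewrite !rsumN.
Qed.

Lemma csum0 : csum (fun _ : X => 0 : C) = 0.
Proof.
have z : rsum (fun _ : X => 0 : R) = 0 by rewrite rsum_ge0E// /total esum1.
by rewrite /csum /= !z.
Qed.

Lemma csummable0 : csummable (fun _ : X => 0 : C).
Proof.
apply: (@csummable_le _ (fun=> 0)); first by move=> x; rewrite Normc.normc0.
by rewrite /total esum1// ltry.
Qed.

Lemma csum_sum (I : Type) (s : seq I) (F : I -> X -> C) :
  (forall i, csummable (F i)) ->
  csummable (fun x => \sum_(i <- s) F i x) /\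
  csum (fun x => \sum_(i <- s) F i x) = \sum_(i <- s) csum (F i).
Proof.
move=> sF; elim: s => [|i s [IH1 IH2]].
  rewrite big_nil (@csum_eq _ (fun=> 0)) ?csum0 => [|x]; last by rewrite big_nil.
  split=> //; have := csummable0; congr csummable; apply/funext => x.
  by rewrite big_nil.
have E : (fun x => \sum_(j <- i :: s) F j x) = (fun x => F i x + \sum_(j <- s) F j x).
  by apply/funext => x; rewrite big_cons.
rewrite E; split; first exact: csummableD.
by rewrite csumD// IH2 big_cons.
Qed.

Lemma csum_reindex (e e' : X -> X) f : cancel e e' -> cancel e' e ->
  csum (fun x => f (e x)) = csum f.
Proof.
move=> ee' e'e; rewrite /csum -(rsum_reindex (fun x => complex.Re (f x)) ee' e'e).
by rewrite -(rsum_reindex (fun x => complex.Im (f x)) ee' e'e).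
Qed.

Definition nrmsq v : R := fine (sqnorm v).

Lemma sqnorm_fin v : sqnorm v \is a fin_num.
Proof. by rewrite ge0_fin_numE ?sqnorm_ge0//; have := ell2P v; rewrite inE. Qed.

Lemma nrmsqE v : (nrmsq v)%:E = sqnorm v.
Proof. by rewrite fineK// sqnorm_fin. Qed.

Lemma nrmsq_ge0 v : 0 <= nrmsq v.
Proof. by rewrite fine_ge0// sqnorm_ge0. Qed.

Lemma nrmsq_le (c : R) u v : 0 <= c ->
  (forall x, normc (u x) ^+ 2 <= c * normc (v x) ^+ 2) -> nrmsq u <= c * nrmsq v.
Proof.
move=> c0 uv; rewrite -lee_fin EFinM !nrmsqE.
have uv' : (total (fun x => normc (u x) ^+ 2)%R <= total (fun x => c * normc (v x) ^+ 2)%R)%E.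
  exact: total_mono.
exact: le_trans uv' (totalZ_le c0 (fun x => sqr_ge0 (normc (v x)))).
Qed.

Lemma nrmsqZ_le (c : C) v : nrmsq (c *: v) <= normc c ^+ 2 * nrmsq v.
Proof.
apply: nrmsq_le => [|x]; first by rewrite sqr_ge0.
by rewrite -exprMn -Normc.normcM.
Qed.

(** Half of the parallelogram law; the constant is harmless in approximations. *)
Lemma nrmsqD_le u v : nrmsq (u + v) <= 2 * nrmsq u + 2 * nrmsq v.
Proof.
rewrite -lee_fin EFinD !EFinM !nrmsqE.
have := sqnormD_le 1 u v; rewrite Normc.normc1 expr1n mulr1.
congr (_ <= _)%E; congr sqnorm; apply/funext => x.
by rewrite mul1r.
Qed.

Lemma nrmsq0 : nrmsq 0 = 0.
Proof.
rewrite /nrmsq /sqnorm esum1// => x _.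
by rewrite (_ : normc _ = 0) ?expr0n//; exact: Normc.normc0.
Qed.

Lemma nrmsq_eq0 v : nrmsq v = 0 -> v = 0.
Proof.
move=> v0; apply: val_inj; apply/funext => x /=; apply: Normc.eq0_normc.
apply/eqP; rewrite -sqrf_eq0 eq_le sqr_ge0 andbT -lee_fin -v0 nrmsqE.
apply: esum_ge; exists [set x]%classic; first by split.
by rewrite fsbig_set1.
Qed.

Lemma inner_term_le u v x : normc (u x * conjc (v x)) <= normc (u x) ^+ 2 + normc (v x) ^+ 2.
Proof.
rewrite Normc.normcM normc_conjc; have := sqr_ge0 (normc (u x) - normc (v x)).
have := sqr_ge0 (normc (u x)); have := sqr_ge0 (normc (v x)); lra.
Qed.

Lemma total_sqr v : (total (fun x => normc (v x) ^+ 2)%R < +oo)%E.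
Proof. by have := ell2P v; rewrite inE. Qed.

Lemma inner_summable u v : csummable (fun x => u x * conjc (v x)).
Proof.
apply: (csummable_le (inner_term_le u v)); rewrite totalD => [|x|x]; rewrite ?sqr_ge0//.
by rewrite lte_add_pinfty// total_sqr.
Qed.

Lemma innerDl u v w : inner (u + v) w = inner u w + inner v w.
Proof.
rewrite /inner -csumD; try exact: inner_summable.
by apply: csum_eq => x; rewrite -mulrDl.
Qed.

Lemma innerNl u w : inner (- u) w = - inner u w.
Proof. by rewrite /inner -csumN; apply: csum_eq => x; rewrite -mulNr. Qed.

Lemma innerDr u v w : inner w (u + v) = inner w u + inner w v.
Proof.
rewrite /inner -csumD; try exact: inner_summable.
apply: csum_eq => x; rewrite -mulrDr; congr (_ * _).
by rewrite -rmorphD.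
Qed.

Lemma innerNr u w : inner w (- u) = - inner w u.
Proof.
rewrite /inner -csumN; apply: csum_eq => x; rewrite -mulrN; congr (_ * _).
by rewrite -rmorphN.
Qed.

Lemma innerBl u v w : inner (u - v) w = inner u w - inner v w.
Proof. by rewrite innerDl innerNl. Qed.

Lemma innerBr u v w : inner w (u - v) = inner w u - inner w v.
Proof. by rewrite innerDr innerNr. Qed.

Lemma inner_self v : complex.Re (inner v v) = nrmsq v.
Proof.
rewrite /= rsum_ge0E => [|x]; last first.
  by case: (v x) => a b /=; rewrite mulrN opprK addr_ge0// -expr2 sqr_ge0.
congr fine; apply: eq_esum => x _; congr (_%:E).
case: (v x) => a b /=; rewrite sqr_sqrtr ?addr_ge0 ?sqr_ge0//; ring.
Qed.

(** Cauchy-Schwarz in the form given by the weighted arithmetic-geometric mean; the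
    parameter t is to be optimized by the user. *)
Lemma Re_inner_le (t : R) u v : 0 < t ->
  2 * complex.Re (inner u v) <= t * nrmsq u + t^-1 * nrmsq v.
Proof.
move=> t0; have t0' : 0 <= t^-1 by rewrite invr_ge0 ltW.
pose g x := (t / 2) * normc (u x) ^+ 2 + (t^-1 / 2) * normc (v x) ^+ 2.
have g1 x : 0 <= (t / 2) * normc (u x) ^+ 2 by rewrite mulr_ge0 ?sqr_ge0 ?divr_ge0 ?ltW.
have g2 x : 0 <= (t^-1 / 2) * normc (v x) ^+ 2 by rewrite mulr_ge0 ?sqr_ge0 ?divr_ge0.
have tg : (total g <= ((t / 2) * nrmsq u + (t^-1 / 2) * nrmsq v)%:E)%E.
  rewrite (totalD g1 g2) EFinD !EFinM !nrmsqE; apply: leeD; apply: totalZ_le => //;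
    by [rewrite divr_ge0// ltW|rewrite divr_ge0|move=> x; rewrite sqr_ge0].
have le : complex.Re (inner u v) <= fine (total g).
  apply: rsum_le => [x|x|]; last 2 first.
  - by rewrite addr_ge0.
  - by apply: le_lt_trans tg _; rewrite ltry.
  apply: (le_trans (ler_norm _)); apply: (le_trans (Re_le_normc _)).
  rewrite Normc.normcM normc_conjc /g.
  move: (normc (u x)) (normc (v x)) => a b.
  have : 0 <= t^-1 * (t * a - b) ^+ 2 by rewrite mulr_ge0 ?sqr_ge0.
  have -> : t^-1 * (t * a - b) ^+ 2 = t * a ^+ 2 - 2 * (a * b) + t^-1 * b ^+ 2.
    by field; rewrite gt_eqF.
  by lra.
have : fine (total g) <= (t / 2) * nrmsq u + (t^-1 / 2) * nrmsq v.
  have fg : total g \is a fin_num.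
    rewrite ge0_fin_numE ?(le_lt_trans tg) ?ltry// total_ge0// => x.
    by rewrite addr_ge0.
  by rewrite -lee_fin fineK.
move: le; lra.
Qed.

End ComplexSums.

(** * Band matrices over the integers and their operators *)

Section BandMatrices.
Context {R : realType}.
Local Notation C := R[i].
Local Notation Z := (Zmet R).
Local Notation mat := (Z -> Z -> C).
Implicit Types (a b c : mat) (v : Z -> C).

Definition band (w : nat) a := forall x y : Z, (w%:Z < `|(x : int) - y|)%R -> a x y = 0.

Definition win (x : Z) (w : nat) : seq Z :=
  [seq ((x : int) - w%:Z + i%:Z : Z) | i <- iota 0 (w + w).+1].

Lemma win_uniq x w : uniq (win x w).
Proof. by rewrite map_inj_uniq ?iota_uniq// => i j /= /addrI; case. Qed.

Lemma mem_win x w (y : Z) : (`|(x : int) - y| <= w%:Z)%R -> y \in win x w.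
Proof.
move=> h; apply/mapP; exists (absz ((y : int) - x + w%:Z)); last by rewrite /=; lia.
by rewrite mem_iota; lia.
Qed.

Lemma size_win x w : size (win x w) = (w + w).+1.
Proof. by rewrite size_map size_iota. Qed.

Lemma Cu_bandP a : Cu Z a <->
  (exists M : R, forall x y, normc (a x y) <= M) /\ exists w, band w a.
Proof.
split=> [Ca|[hM [w aw]]].
  have [r [_ [_ ar]]] := Cu_finite_rows (@Zmet_bounded_geometry R) Ca.
  split; first by case: Ca.
  exists (absz (Num.ceil r)) => x y xy; apply: ar.
  change (r < (`|(x : int) - y|)%:~R).
  apply: (le_lt_trans (ceil_ge r)); rewrite ltr_int; apply: le_lt_trans xy.
  exact: lez_abs.
split=> //; apply: (@le_lt_trans _ _ (w%:R)%:E); last by rewrite ltry.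
apply: ge_ereal_sup => _ [[x y] /= axy <-]; rewrite lee_fin.
change ((`|(x : int) - y|)%:~R <= w%:R :> R); rewrite pmulrn ler_int leNgt.
by apply/negP => /aw /eqP; rewrite (negPf axy).
Qed.

Lemma fsumE (f : Z -> C) (s : seq Z) : uniq s -> (forall y, y \notin s -> f y = 0) ->
  \sum_(y \in [set: Z]) f y = \sum_(y <- s) f y.
Proof.
move=> us fs; rewrite (@fsbigE _ _ _ _ _ s)//; last by move=> y _; exact: fs.
by apply: eq_bigl => y; rewrite in_setT.
Qed.

Definition covers (s : seq Z) (x : Z) (w : nat) :=
  forall y : Z, (`|(x : int) - y| <= w%:Z)%R -> y \in s.

(** Infinite matrix products reduce to sums over any finite set of indices that
    contains the window of the row. *)
Lemma mx_apply_sum a w s v x : band w a -> uniq s -> covers s x w ->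
  mx_apply a v x = \sum_(y <- s) a x y * v y.
Proof.
move=> aw us sw; apply: fsumE => // y ys; rewrite aw ?mul0r//.
by rewrite ltNge; apply: contra ys; exact: sw.
Qed.

Definition mprod a b : mat := fun x z => \sum_(y \in [set: Z]) a x y * b y z.

Lemma mprod_sum a b w s x z : band w a -> uniq s -> covers s x w ->
  mprod a b x z = \sum_(y <- s) a x y * b y z.
Proof. by move=> aw us sw; exact: (mx_apply_sum (fun y => b y z) aw us sw). Qed.

Definition adj a : mat := fun x y => conjc (a y x).

Lemma band_adj w a : band w a -> band w (adj a).
Proof. by move=> aw x y xy; rewrite /adj aw ?conjc0// distrC. Qed.

Lemma band_mprod w w' a b : band w a -> band w' b -> band (w + w') (mprod a b).
Proof.
move=> aw bw x z xz; rewrite (mprod_sum _ _ aw (win_uniq x w) (@mem_win x w)).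
apply: big1_seq => y /andP[_ _].
have [xy|xy] := leP `|(x : int) - y| w%:Z; last by rewrite (aw _ _ xy) mul0r.
rewrite (bw y z) ?mulr0//; have := ler_distD (y : int) (x : int) (z : int); lia.
Qed.

Lemma adjK a : adj (adj a) = a.
Proof. by apply/funext => x; apply/funext => y; rewrite /adj conjcK. Qed.

Lemma Cu_adj a : Cu Z a -> Cu Z (adj a).
Proof.
move=> /Cu_bandP[[M hM] [w aw]]; apply/Cu_bandP; split.
  by exists M => x y; rewrite normc_conjc.
by exists w; exact: band_adj.
Qed.

Lemma Cu_mprod a b : Cu Z a -> Cu Z b -> Cu Z (mprod a b).
Proof.
move=> /Cu_bandP[[M hM] [w aw]] /Cu_bandP[[M' hM'] [w' bw]]; apply/Cu_bandP; split.
  exists ((w + w).+1%:R * (M * M')) => x z.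
  rewrite (mprod_sum _ _ aw (win_uniq x w) (@mem_win x w)).
  apply: (le_trans (normc_sum _ _)).
  rewrite -(size_win x w) mulr_natl -iter_addr_0 -count_predT -big_const_seq.
  apply: ler_sum => y _; rewrite Normc.normcM.
  by rewrite ler_pM ?normc_ge0.
by exists (w + w')%N; exact: band_mprod.
Qed.

Lemma Cu_add a b : Cu Z a -> Cu Z b -> Cu Z (fun x y => a x y + b x y).
Proof.
move=> /Cu_bandP[[M hM] [w aw]] /Cu_bandP[[M' hM'] [w' bw]]; apply/Cu_bandP; split.
  by exists (M + M') => x z; apply: (le_trans (le_normcD _ _)); exact: lerD.
by exists (maxn w w') => x y xy; rewrite aw ?bw ?addr0//; lia.
Qed.

Lemma Cu_scale (k : C) a : Cu Z a -> Cu Z (fun x y => k * a x y).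
Proof.
move=> /Cu_bandP[[M hM] [w aw]]; apply/Cu_bandP; split.
  by exists (normc k * M) => x z; rewrite Normc.normcM ler_wpM2l ?normc_ge0.
by exists w => x y xy; rewrite aw ?mulr0.
Qed.

Definition dg (f : Z -> C) : mat := fun x y => if x == y then f x else 0.

Lemma band_dg f : band 0 (dg f).
Proof. by move=> x y; rewrite /dg; case: eqP => // ->; rewrite subrr. Qed.

Lemma Cu_dg (f : Z -> C) (M : R) : (forall x, normc (f x) <= M) -> Cu Z (dg f).
Proof.
move=> fM; apply/Cu_bandP; split; last by exists 0%N; exact: band_dg.
exists M => x y; rewrite /dg; case: eqP => [_//|_].
by rewrite Normc.normc0 (le_trans _ (fM x))// normc_ge0.
Qed.

Lemma mx_apply_mprod a b v : Cu Z a -> Cu Z b ->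
  mx_apply (mprod a b) v = mx_apply a (mx_apply b v).
Proof.
move=> /Cu_bandP[_ [w aw]] /Cu_bandP[_ [w' bw]]; apply/funext => x.
have cov : covers (win x (w + w')) x (w + w') := @mem_win x _.
have us := win_uniq x (w + w').
rewrite (mx_apply_sum _ (band_mprod aw bw) us cov).
rewrite (mx_apply_sum _ aw (win_uniq x w) (@mem_win x w)).
under eq_bigr do rewrite (mprod_sum _ _ aw (win_uniq x w) (@mem_win x w)) mulr_suml.
rewrite exchange_big /=; apply: eq_big_seq => y /mapP[i ii ->].
set y' : Z := _ + _.
rewrite (mx_apply_sum _ bw us) => [|z yz]; last first.
  apply: cov; move: ii yz; rewrite mem_iota /y'; lia.
by rewrite mulr_sumr; apply: eq_bigr => z _; rewrite mulrA.
Qed.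

(** The default value 0 is taken when the image of v is not square summable,
    which does not happen for a in C_u. *)
Definition op a (v : ell2 R Z) : ell2 R Z := insubd (0 : ell2 R Z) (mx_apply a v).

Lemma opE a (v : ell2 R Z) : Cu Z a -> op a v = mx_apply a v :> (Z -> C).
Proof.
move=> Ca; have [T _ TE] := Cu_bounded_operator (@Zmet_bounded_geometry R) Ca.
by rewrite /op -TE /insubd valK.
Qed.

Lemma op_bounded a : Cu Z a -> bounded_operator (op a).
Proof.
move=> Ca; have [T bT TE] := Cu_bounded_operator (@Zmet_bounded_geometry R) Ca.
suff -> : op a = T by [].
by apply/funext => v; apply: val_inj; rewrite /= opE.
Qed.

Lemma op_mprod a b : Cu Z a -> Cu Z b -> op (mprod a b) = op a \o op b.
Proof.
move=> Ca Cb; apply/funext => v; apply: val_inj => /=.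
by rewrite opE ?mx_apply_mprod ?opE//; exact: Cu_mprod.
Qed.

Lemma op_add a b (v : ell2 R Z) : Cu Z a -> Cu Z b ->
  op (fun x y => a x y + b x y) v = op a v + op b v.
Proof.
move=> Ca Cb; apply: val_inj => /=; rewrite opE; last exact: Cu_add.
apply/funext => x; move: (Ca) (Cb) => /Cu_bandP[_ [w aw]] /Cu_bandP[_ [w' bw]].
have us := win_uniq x (maxn w w').
have caw : covers (win x (maxn w w')) x w by move=> y xy; apply: mem_win; lia.
have cbw : covers (win x (maxn w w')) x w' by move=> y xy; apply: mem_win; lia.
have abw : band (maxn w w') (fun x y => a x y + b x y).
  by move=> ? ? ?; rewrite aw ?bw ?addr0//; lia.
change (mx_apply (fun x y => a x y + b x y) v x = op a v x + op b v x).
rewrite !opE// (mx_apply_sum _ abw us (@mem_win _ _)) (mx_apply_sum _ aw us caw).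
rewrite (mx_apply_sum _ bw us cbw) -big_split; apply: eq_bigr => y _ /=.
by rewrite mulrDl.
Qed.

Lemma op_scale (k : C) a (v : ell2 R Z) : Cu Z a ->
  op (fun x y => k * a x y) v = k *: op a v.
Proof.
move=> Ca; apply: val_inj => /=; rewrite opE; last exact: Cu_scale.
apply/funext => x; move: (Ca) => /Cu_bandP[_ [w aw]].
have kaw : band w (fun x y => k * a x y) by move=> ? ? ?; rewrite aw ?mulr0.
change (mx_apply (fun x y => k * a x y) v x = k * op a v x).
rewrite !opE// (mx_apply_sum _ kaw (win_uniq x w) (@mem_win _ _)).
rewrite (mx_apply_sum _ aw (win_uniq x w) (@mem_win _ _)) mulr_sumr.
by apply: eq_bigr => y _; rewrite mulrA.
Qed.

Lemma op_dg (f : Z -> C) (M : R) (v : ell2 R Z) x :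
  (forall x, normc (f x) <= M) -> op (dg f) v x = f x * v x.
Proof.
move=> fM; rewrite opE; last exact: Cu_dg fM.
have cov : covers [:: x] x 0 by move=> y xy; rewrite inE; apply/eqP; lia.
by rewrite (mx_apply_sum _ (@band_dg f) _ cov)// big_seq1 /dg eqxx.
Qed.

Lemma op1 : op (dg (fun=> 1)) = idfun.
Proof.
apply/funext => v; apply: val_inj; apply/funext => x /=.
by rewrite (@op_dg _ 1) ?mul1r// => ?; rewrite Normc.normc1.
Qed.

End BandMatrices.

Section Adjoint.
Context {R : realType}.
Local Notation C := R[i].
Local Notation Z := (Zmet R).
Local Notation mat := (Z -> Z -> C).

Definition shift (k : int) : Z -> Z := fun x => (x : int) + k.

Lemma shiftK k : cancel (shift k) (shift (- k)).
Proof. by move=> x; rewrite /shift addrK. Qed.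

Lemma shiftNK k : cancel (shift (- k)) (shift k).
Proof. by move=> x; rewrite /shift subrK. Qed.

Lemma total_shift k (f : Z -> R) : total (fun x => f (shift k x)) = total f.
Proof.
have be : set_bij [set: Z] [set: Z] (shift k).
  split=> // [x y _ _ /(can_inj (@shiftK k))//|x _].
  by exists (shift (- k) x) => //; exact: shiftNK.
by rewrite /total [RHS](@reindex_esum R _ _ _ _ (shift k) _ be).
Qed.

(** A band matrix is a finite sum of weighted shifts, for which the identity is a
    translation of the index of summation. *)
Lemma inner_op (a : mat) (v w : ell2 R Z) : Cu Z a ->
  inner (op a v) w = inner v (op (adj a) w).
Proof.
move=> Ca; have Ca' := Cu_adj Ca; move: (Ca) => /Cu_bandP[[M hM] [d ad]].
have M0 : 0 <= M by apply: le_trans (hM 0 0); exact: normc_ge0.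
(* The product with a is decomposed along the diagonals y = x + e k. *)
pose e (k : nat) : int := k%:Z - d%:Z.
pose F k x := a x (shift (e k) x) * v (shift (e k) x) * conjc (w x).
have sF k : csummable (F k).
  apply: (@csummable_le _ _ _ (fun x => M * normc (v (shift (e k) x)) ^+ 2 + M * normc (w x) ^+ 2)).
    move=> x; rewrite /F -mulrA Normc.normcM -mulrDr.
    apply: ler_pM; rewrite ?normc_ge0// Normc.normcM normc_conjc.
    have := sqr_ge0 (normc (v (shift (e k) x)) - normc (w x)).
    have := sqr_ge0 (normc (v (shift (e k) x))); have := sqr_ge0 (normc (w x)); lra.
  rewrite totalD; try by move=> z; rewrite mulr_ge0 ?sqr_ge0.
  apply: lte_add_pinfty.
    apply: le_lt_trans (totalZ_le M0 _) _; first by move=> x; rewrite sqr_ge0.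
    rewrite (total_shift (e k) (fun x => normc (v x) ^+ 2)).
    by rewrite lte_mul_pinfty// ?total_sqr// lee_fin.
  apply: le_lt_trans (totalZ_le M0 _) _; first by move=> x; rewrite sqr_ge0.
  by rewrite lte_mul_pinfty// ?total_sqr// lee_fin.
have lhs x : op a v x * conjc (w x) = \sum_(k <- iota 0 (d + d).+1) F k x.
  rewrite opE// (mx_apply_sum _ ad (win_uniq x d) (@mem_win _ x d)).
  rewrite mulr_suml /win big_map; apply: eq_bigr => k _.
  by rewrite /F /shift /e addrA addrAC.
have rhs x : v x * conjc (op (adj a) w x) =
    \sum_(k <- iota 0 (d + d).+1) F k (shift (- e k) x).
  pose s := [seq shift (- e k) x | k <- iota 0 (d + d).+1].
  have us : uniq s.
    rewrite map_inj_uniq ?iota_uniq// => i j; rewrite /shift /e => /addrI.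
    by move/oppr_inj/addIr => [].
  have cs : covers s x d.
    move=> y xy; apply/mapP; exists (absz ((x : int) - y + d%:Z)).
      by rewrite mem_iota; lia.
    by rewrite /shift /e /=; lia.
  rewrite opE// (mx_apply_sum _ (band_adj ad) us cs) /s big_map rmorph_sum mulr_sumr.
  apply: eq_bigr => k _; rewrite /F shiftNK rmorphM /adj /= conjcK.
  by rewrite mulrCA mulrA.
rewrite /inner (csum_eq lhs) (csum_eq rhs).
have sF' k : csummable (fun x => F k (shift (- e k) x)).
  have [s1 s2] := sF k; split.
    by rewrite /abs_summable (total_shift _ (fun x => `|complex.Re (F k x)|)).
  by rewrite /abs_summable (total_shift _ (fun x => `|complex.Im (F k x)|)).
rewrite (csum_sum _ sF).2 (csum_sum _ sF').2; apply: eq_bigr => k _.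
by rewrite (csum_reindex (F k) (@shiftNK (e k)) (@shiftK (e k))).
Qed.

End Adjoint.

Section Estimates.
Context {R : realType}.
Local Notation C := R[i].
Local Notation Z := (Zmet R).
Local Notation mat := (Z -> Z -> C).
Implicit Types (T S : ell2 R Z -> ell2 R Z).

(** For c >= 0 this is the bound c on the operator norm, without square roots. *)
Definition bounded_by (c : R) T : Prop := forall v, nrmsq (T v) <= c ^+ 2 * nrmsq v.

Lemma opnorm_le (c : R) T : 0 <= c -> bounded_by c T -> (opnorm T <= c%:E)%E.
Proof.
move=> c0 Tc; apply: ge_ereal_sup => _ [v /= v1 <-]; rewrite lee_fin /ell2norm.
have n1 : nrmsq v <= 1 by move: v1; rewrite /ell2norm -[leRHS]sqrtr1 ler_sqrt.
rewrite -[leRHS](ger0_norm c0) -sqrtr_sqr ler_wsqrtr//.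
apply: (le_trans (Tc v)); rewrite -[leRHS]mulr1 ler_wpM2l ?sqr_ge0//.
Qed.

Lemma bounded_by_opnorm (c : R) T : linear T -> 0 <= c -> (opnorm T <= c%:E)%E -> bounded_by c T.
Proof.
move=> lT c0 Tc v; have TZ (k : C) u : T (k *: u) = k *: T u.
  have T0 : T 0 = 0.
    have := lT 1 0 0; rewrite !scale1r !addr0 => /esym/eqP.
    by rewrite -subr_eq0 addrK => /eqP.
  by have := lT k u 0; rewrite !addr0 T0 addr0.
have [v0|v0] := eqVneq (nrmsq v) 0.
  by rewrite v0 (nrmsq_eq0 v0) -(scale0r v) TZ scale0r nrmsq0 mulr0.
have n0 : 0 < nrmsq v by rewrite lt_def v0 nrmsq_ge0.
pose s := Num.sqrt (nrmsq v); have s0 : 0 < s by rewrite sqrtr_gt0.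
have sn0 : s != 0 by rewrite gt_eqF.
have s1 : 0 <= s^-1 by rewrite invr_ge0 ltW.
have s2 : s ^+ 2 = nrmsq v by rewrite sqr_sqrtr// ltW.
have nC (r : R) : 0 <= r -> normc (Complex r 0) = r.
  by move=> r0; rewrite /= expr0n addr0 sqrtr_sqr ger0_norm.
pose u := Complex s^-1 0 *: v.
have u1 : ell2norm u <= 1.
  rewrite -[leRHS]sqrtr1; apply: ler_wsqrtr.
  apply: (le_trans (nrmsqZ_le _ _)); rewrite (nC _ s1) -s2.
  by rewrite -exprMn mulVf// expr1n.
have Tu : nrmsq (T u) <= c ^+ 2.
  have : ((ell2norm (T u))%:E <= c%:E)%E.
    by apply: le_trans Tc; apply: ereal_sup_ubound; exists u.
  rewrite lee_fin /ell2norm => h.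
  rewrite -(sqr_sqrtr (nrmsq_ge0 (T u))) ler_pXn2r// ?nnegrE// sqrtr_ge0//.
have -> : T v = Complex s 0 *: T u.
  rewrite /u TZ scalerA (_ : _ * _ = 1) ?scale1r//.
  by apply/eqP; rewrite eq_complex /= !mulr0 !mul0r subr0 addr0 divff// !eqxx.
apply: (le_trans (nrmsqZ_le _ _)); rewrite (nC _ (ltW s0)) s2 mulrC.
by rewrite ler_wpM2r// ltW.
Qed.

(** |T' v| ^ 2 is the inner product of T T' v and v, estimated by
    [Re_inner_le] with t = 1 / c ^ 2. *)
Lemma bounded_by_adjoint (c : R) T T' : 0 < c ->
  (forall v w, inner (T v) w = inner v (T' w)) -> bounded_by c T -> bounded_by c T'.
Proof.
move=> c0 TT' Tc v; have c2 : 0 < c ^+ 2 by rewrite exprn_gt0.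
have := Re_inner_le (T (T' v)) v (t := (c ^+ 2)^-1); rewrite invr_gt0 => /(_ c2).
rewrite TT' inner_self invrK => h.
have := Tc (T' v); rewrite -(ler_pM2l (_ : 0 < (c ^+ 2)^-1)) ?invr_gt0//.
rewrite mulrA mulVf ?gt_eqF// mul1r; move: h; lra.
Qed.

Lemma bounded_by_avg (c : R) T T' :
  bounded_by c T -> bounded_by c T' ->
  bounded_by c (fun v => (2^-1 : C) *: T v + (2^-1 : C) *: T' v).
Proof.
move=> Tc Tc' v; apply: (le_trans (nrmsqD_le _ _)).
have n2 : normc (2^-1 : C) ^+ 2 = 4^-1.
  rewrite Normc.normcV (_ : normc (2 : C) = 2) ?exprVn; first by congr (_^-1); ring.
  by rewrite /= addr0 expr0n addr0 sqrtr_sqr ger0_norm.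
have := nrmsqZ_le (2^-1 : C) (T v); have := nrmsqZ_le (2^-1 : C) (T' v).
rewrite !n2; have := Tc v; have := Tc' v; lra.
Qed.

Lemma bounded_by_dg (f : Z -> C) (c : R) : (forall x, normc (f x) <= c) ->
  bounded_by c (op (dg f)).
Proof.
move=> fc v; apply: nrmsq_le => [|x]; first exact: sqr_ge0.
rewrite (op_dg _ _ fc) Normc.normcM exprMn ler_wpM2r ?sqr_ge0//.
by rewrite ler_pXn2r ?nnegrE ?normc_ge0// (le_trans _ (fc x)) ?normc_ge0.
Qed.

Lemma isometry_op (a : mat) v : Cu Z a -> mprod (adj a) a = dg (fun=> 1) ->
  nrmsq (op a v) = nrmsq v.
Proof.
move=> Ca aa; rewrite -inner_self inner_op// -[op _ (op _ _)]/((op (adj a) \o op a) v).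
by rewrite -op_mprod ?aa ?op1 ?inner_self//; exact: Cu_adj.
Qed.

Lemma selfadjoint_op (a : mat) : Cu Z a -> adj a = a -> selfadjoint (op a).
Proof.
move=> Ca aa v w.
exact (etrans (inner_op v w Ca) (congr1 (fun b => inner v (op b w)) aa)).
Qed.

End Estimates.

(** * Gluing and diagonalizing block diagonal matrices *)

Section Blocks.
Context {R : realType}.
Local Notation C := R[i].
Local Notation Z := (Zmet R).
Local Notation mat := (Z -> Z -> C).

Lemma mprod_on (a b : mat) x z (s : seq Z) : uniq s ->
  (forall y, y \notin s -> a x y = 0) -> mprod a b x z = \sum_(y <- s) a x y * b y z.
Proof. by move=> us a0; apply: fsumE => // y /a0 ->; rewrite mul0r. Qed.

Section Enumeration.
Variable s : seq Z.
Hypothesis us : uniq s.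
Local Notation d := (size s).
Local Notation e := (fun i : 'I_d => nth (0 : Z) s i).

Lemma big_enum_seq (V : nmodType) (F : Z -> V) : \sum_(z <- s) F z = \sum_(i < d) F (e i).
Proof. by rewrite (big_nth (0 : Z)) big_mkord. Qed.

(** Functions on pairs of integers are used for the blocks so that blocks of
    different sizes can be glued. *)
Definition lift_mx (U : 'M[C]_d) : mat := fun x y =>
  if (insub (index x s), insub (index y s)) is (Some i, Some k) then U i k else 0.

Lemma lift_mxE U i k : lift_mx U (e i) (e k) = U i k.
Proof.
rewrite /lift_mx !index_uniq//; case: insubP => [i' _ ii|]; last by rewrite ltn_ord.
case: insubP => [k' _ kk|]; last by rewrite ltn_ord.
by congr (U _ _); apply: val_inj.
Qed.

Lemma enum_seqP x : x \in s -> exists i : 'I_d, x = e i.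
Proof.
by move=> xs; exists (Ordinal (eq_ind_r is_true xs (index_mem x s))); rewrite /= nth_index.
Qed.

Lemma enum_seq_inj (i k : 'I_d) : (e i == e k) = (i == k).
Proof. by rewrite nth_uniq. Qed.

Lemma lift_mx_row U x y : U *m U^t* = 1%:M -> x \in s -> y \in s ->
  \sum_(z <- s) lift_mx U x z * conjc (lift_mx U y z) = (x == y)%:R.
Proof.
move=> UU /enum_seqP[i ->] /enum_seqP[k ->]; rewrite big_enum_seq enum_seq_inj.
have /matrixP/(_ i k) := UU; rewrite !mxE => <-.
by apply: eq_bigr => j _; rewrite !lift_mxE !mxE.
Qed.

Lemma lift_mx_col U x y : U^t* *m U = 1%:M -> x \in s -> y \in s ->
  \sum_(z <- s) conjc (lift_mx U z x) * lift_mx U z y = (x == y)%:R.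
Proof.
move=> UU /enum_seqP[i ->] /enum_seqP[k ->]; rewrite big_enum_seq enum_seq_inj.
have /matrixP/(_ i k) := UU; rewrite !mxE => <-.
by apply: eq_bigr => j _; rewrite !lift_mxE !mxE.
Qed.

Definition diagonalizes (b : mat) (U : 'M[C]_d) (f : Z -> R) : Prop :=
  [/\ U *m U^t* = 1%:M, U^t* *m U = 1%:M,
    forall x y, x \in s -> y \in s -> b x y =
      \sum_(z <- s) conjc (lift_mx U z x) * (Complex (f z) 0 * lift_mx U z y)
  & forall z, z \in s -> Complex (f z) 0 =
      \sum_(x <- s) \sum_(y <- s) lift_mx U z x * b x y * conjc (lift_mx U z y)].

(** The spectral theorem for the finite submatrix of b on s. *)
Lemma local_diagonalize (b : mat) : (forall x y, conjc (b x y) = b y x) ->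
  exists U f, diagonalizes b U f.
Proof.
move=> bh; pose B : 'M[C]_d := \matrix_(i, k) b (e i) (e k).
have Bh : B^t* = B by apply/matrixP => i k; rewrite !mxE; exact: bh.
have [U [t [UU UU' BE treal]]] := spectral_hermitian Bh.
exists U, (fun x => if insub (index x s) is Some i then complex.Re (t 0 i) else 0).
have fE (i : 'I_d) : Complex (if insub (index (e i) s) is Some i then complex.Re (t 0 i) else 0) 0 = t 0 i.
  rewrite index_uniq//; case: insubP => [i' _ ii|]; last by rewrite ltn_ord.
  by have -> : i' = i by [apply: val_inj]; exact: RRe_real.
split=> //.
- move=> x y /enum_seqP[i ->] /enum_seqP[k ->].
  have -> : b (e i) (e k) = B i k by rewrite mxE.
  rewrite BE mul_mx_diag mxE big_enum_seq; apply: eq_bigr => j _.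
  by rewrite fE !lift_mxE !mxE mulrA.
- move=> z /enum_seqP[j ->]; rewrite fE.
  have : diag_mx t = U *m B *m U^t*.
    by rewrite BE !mulmxA UU mul1mx -mulmxA UU mulmx1.
  move/matrixP/(_ j j); rewrite mxE eqxx mulr1n => ->.
  rewrite mxE exchange_big /= big_enum_seq; apply: eq_bigr => k _.
  rewrite mxE mulr_suml big_enum_seq; apply: eq_bigr => i _.
  by rewrite !lift_mxE !mxE.
Qed.

End Enumeration.

Section Glue.
Variables (beta : Z -> int) (W : nat) (s : int -> seq Z).
Hypothesis diam : forall x y : Z, beta x = beta y -> (`|(x : int) - y| <= W%:Z)%R.
Hypothesis s_uniq : forall c, uniq (s c).
Hypothesis mem_s : forall c x, (x \in s c) = (beta x == c).

Definition glue (U : forall c, 'M[C]_(size (s c))) : mat := fun x y =>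
  if beta x == beta y then lift_mx (U (beta x)) x y else 0.

Lemma glueE U x y : beta x = beta y -> glue U x y = lift_mx (U (beta x)) x y.
Proof. by rewrite /glue => ->; rewrite eqxx. Qed.

Lemma glue_supp U x y : glue U x y != 0 -> beta x = beta y.
Proof. by rewrite /glue; case: (beta x =P beta y) => // _; rewrite eqxx. Qed.

Lemma glue_off U x y : y \notin s (beta x) -> glue U x y = 0.
Proof. by rewrite /glue mem_s eq_sym => /negPf ->. Qed.

Lemma adj_glue_off U x y : y \notin s (beta x) -> adj (glue U) x y = 0.
Proof. by rewrite /adj /glue mem_s => /negPf ->; rewrite conjc0. Qed.

Variable U : forall c, 'M[C]_(size (s c)).
Hypothesis UU : forall c, U c *m (U c)^t* = 1%:M.
Hypothesis UU' : forall c, (U c)^t* *m U c = 1%:M.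

Lemma glue_row : mprod (glue U) (adj (glue U)) = dg (fun=> 1).
Proof.
apply/funext => x; apply/funext => y.
rewrite (mprod_on _ _ (s_uniq (beta x)) (@glue_off U x)) /dg.
have [xy|xy] := eqVneq (beta x) (beta y); last first.
  rewrite (_ : (x == y) = false); last by apply: contraNF xy => /eqP ->.
  apply: big1_seq => z; rewrite mem_s => /andP[_ /eqP zx].
  by rewrite /adj /glue [beta y == _]eq_sym zx (negPf xy) conjc0 mulr0.
have := @lift_mx_row _ (s_uniq (beta x)) (U (beta x)) x y (UU _).
rewrite !mem_s -xy eqxx => /(_ isT isT).
have -> : (if x == y then 1 else 0) = (x == y)%:R :> C by case: ifP.
move=> <-; apply: eq_big_seq => z; rewrite mem_s => /eqP zx; rewrite /adj !glueE ?zx// -xy//.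
Qed.

Lemma glue_col : mprod (adj (glue U)) (glue U) = dg (fun=> 1).
Proof.
apply/funext => x; apply/funext => y.
rewrite (mprod_on _ _ (s_uniq (beta x)) (@adj_glue_off U x)) /dg.
have [xy|xy] := eqVneq (beta x) (beta y); last first.
  rewrite (_ : (x == y) = false); last by apply: contraNF xy => /eqP ->.
  apply: big1_seq => z; rewrite mem_s => /andP[_ /eqP zx].
  by rewrite /glue zx (negPf xy) mulr0.
have := @lift_mx_col _ (s_uniq (beta x)) (U (beta x)) x y (UU' _).
rewrite !mem_s -xy eqxx => /(_ isT isT).
have -> : (if x == y then 1 else 0) = (x == y)%:R :> C by case: ifP.
move=> <-; apply: eq_big_seq => z; rewrite mem_s => /eqP zx; rewrite /adj !glueE ?zx// -xy//.
Qed.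

Lemma Cu_glue : Cu Z (glue U).
Proof.
apply/Cu_bandP; split; last first.
  exists W => x y xy; apply/eqP/negP => /negP /glue_supp/diam.
  by rewrite leNgt xy.
exists 1 => x y.
have [->|/glue_supp xy] := eqVneq (glue U x y) 0; first by rewrite Normc.normc0.
have ys : y \in s (beta x) by rewrite mem_s -xy.
have := congr1 (fun a => complex.Re (a x x)) glue_row.
rewrite (mprod_on _ _ (s_uniq (beta x)) (@glue_off U x)) /dg eqxx raddf_sum /=.
have sq (z : C) : complex.Re (z * conjc z) = normc z ^+ 2.
  case: z => p q /=; rewrite sqr_sqrtr ?addr_ge0 ?sqr_ge0//; ring.
under eq_bigr do rewrite sq.
rewrite (bigD1_seq y) //= => E.
have : normc (glue U x y) ^+ 2 <= 1.
  by rewrite -E lerDl sumr_ge0// => z _; rewrite sqr_ge0.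
by rewrite -[X in _ <= X](expr1n _ 2) ler_pXn2r// ?nnegrE ?normc_ge0.
Qed.

End Glue.

Lemma class_enum (beta : Z -> int) (W : nat) :
  (forall x y : Z, beta x = beta y -> (`|(x : int) - y| <= W%:Z)%R) ->
  exists s : int -> seq Z, forall c, uniq (s c) /\ forall x, (x \in s c) = (beta x == c).
Proof.
move=> diam; suff /boolp.choice[s sP] : forall c, exists s : seq Z,
  uniq s /\ forall x, (x \in s) = (beta x == c) by exists s.
move=> c.
have [[x0 x0c]|no] := pselect (exists x, beta x = c); last first.
  exists [::]; split=> // x; rewrite in_nil; apply/esym/eqP => xc.
  by apply: no; exists x.
exists [seq x <- win x0 W | beta x == c]; split.
  by rewrite filter_uniq// win_uniq.
move=> x; rewrite mem_filter; case: (beta x =P c) => //= xc.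
by apply: mem_win; apply: diam; rewrite x0c xc.
Qed.

(** A self-adjoint block diagonal matrix is diagonalized block by block; the
    unitary matrix Y has finite propagation because the classes of beta have
    bounded diameter.  A bound k on the quadratic forms of the blocks bounds the
    eigenvalues, hence the norm, uniformly. *)
Lemma block_diagonalize (beta : Z -> int) (W : nat) (s : int -> seq Z) (b : mat) :
  (forall x y : Z, beta x = beta y -> (`|(x : int) - y| <= W%:Z)%R) ->
  (forall c, uniq (s c)) -> (forall c x, (x \in s c) = (beta x == c)) ->
  adj b = b -> (forall x y, beta x != beta y -> b x y = 0) ->
  exists (Y : mat) (f : Z -> R), [/\ Cu Z Y,
    mprod Y (adj Y) = dg (fun=> 1), mprod (adj Y) Y = dg (fun=> 1),
    b = mprod (adj Y) (mprod (dg (fun z => Complex (f z) 0)) Y)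
  & forall k : R, (forall c (u : Z -> C),
       normc (\sum_(x <- s c) \sum_(y <- s c) u x * b x y * conjc (u y))
         <= k * \sum_(x <- s c) normc (u x) ^+ 2) ->
     forall z, `|f z| <= k].
Proof.
move=> diam s_uniq mem_s bh b0.
have bh' x y : conjc (b x y) = b y x by rewrite -[in RHS]bh.
have loc c := local_diagonalize (s_uniq c) bh'.
pose U c := projT1 (cid (loc c)); pose f c := projT1 (cid (projT2 (cid (loc c)))).
have UfP c : diagonalizes b (U c) (f c) := projT2 (cid (projT2 (cid (loc c)))).
move: U f UfP => U f UfP.
have UU c : U c *m (U c)^t* = 1%:M by case: (UfP c).
have UU' c : (U c)^t* *m U c = 1%:M by case: (UfP c).
exists (glue beta U), (fun z => f (beta z) z); split.
- exact (Cu_glue diam s_uniq mem_s UU).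
- exact (glue_row s_uniq mem_s UU).
- exact (glue_col s_uniq mem_s UU').
- apply/funext => x; apply/funext => y.
  rewrite (mprod_on _ _ (s_uniq (beta x)) (@adj_glue_off _ _ mem_s U x)).
  have dgE z : mprod (dg (fun z => Complex (f (beta z) z) 0)) (glue beta U) z y =
      Complex (f (beta z) z) 0 * glue beta U z y.
    rewrite (@mprod_on _ _ _ _ [:: z])//; last first.
      by move=> y'; rewrite inE /dg eq_sym => /negPf ->.
    by rewrite big_seq1 /dg eqxx.
  under eq_bigr do rewrite dgE.
  have [xy|xy] := eqVneq (beta x) (beta y); last first.
    rewrite b0//; apply/esym/big1_seq => z; rewrite mem_s => /andP[_ /eqP zx].
    by rewrite {2}/glue zx (negPf xy) !mulr0.
  have [_ _ + _] := UfP (beta x) => /(_ x y).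
  rewrite !mem_s -xy eqxx => /(_ isT isT) ->.
  by apply: eq_big_seq => z; rewrite mem_s => /eqP zx; rewrite /adj !glueE ?zx// -xy.
- move=> k kP z; have zs : z \in s (beta z) by rewrite mem_s.
  have [_ _ _ /(_ z zs) fE] := UfP (beta z).
  have := kP (beta z) (lift_mx (U (beta z)) z); rewrite -fE.
  have -> : \sum_(x <- s (beta z)) normc (lift_mx (U (beta z)) z x) ^+ 2 = 1.
    have := congr1 (@complex.Re R) (lift_mx_row (s_uniq _) (UU (beta z)) zs zs).
    rewrite eqxx raddf_sum /= => <-; apply: eq_bigr => x _.
    case: (lift_mx _ _ _) => p q /=; rewrite sqr_sqrtr ?addr_ge0 ?sqr_ge0//; ring.
  by rewrite mulr1 /= expr0n addr0 sqrtr_sqr.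
Qed.

End Blocks.

(** * The algebra of band matrices *)

Section MatrixAlgebra.
Context {R : realType}.
Local Notation C := R[i].
Local Notation Z := (Zmet R).
Local Notation mat := (Z -> Z -> C).
Implicit Types a b : mat.

Lemma mprodA a b (c : mat) : Cu Z a -> Cu Z b -> mprod (mprod a b) c = mprod a (mprod b c).
Proof.
move=> Ca Cb; apply/funext => x; apply/funext => z.
have := mx_apply_mprod (fun y => c y z) Ca Cb.
by move/(congr1 (fun f => f x)).
Qed.

Lemma mprod1l a : mprod (dg (fun=> 1)) a = a.
Proof.
apply/funext => x; apply/funext => z.
rewrite /mprod (@fsumE _ _ [:: x])// ?big_seq1 /dg ?eqxx ?mul1r// => y.
by rewrite inE eq_sym => /negPf ->; rewrite mul0r.
Qed.

Lemma adj_mprod a b : Cu Z a -> Cu Z b -> adj (mprod a b) = mprod (adj b) (adj a).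
Proof.
move=> /Cu_bandP[_ [w aw]] /Cu_bandP[_ [w' bw]]; apply/funext => x; apply/funext => z.
pose s := undup (win z w ++ win x w').
have us : uniq s by rewrite undup_uniq.
have sz : covers s z w by move=> y h; rewrite mem_undup mem_cat mem_win.
have sx : covers s x w' by move=> y h; rewrite mem_undup mem_cat (mem_win h) orbT.
rewrite {1}/adj (mprod_sum _ _ aw us sz) (mprod_sum _ _ (band_adj bw) us sx).
by rewrite rmorph_sum; apply: eq_bigr => y _; rewrite rmorphM mulrC.
Qed.

Lemma adj_dg_real (f : Z -> R) : adj (dg (fun z => Complex (f z) 0)) = dg (fun z => Complex (f z) 0).
Proof.
apply/funext => x; apply/funext => z; rewrite /adj /dg eq_sym.
by case: (x =P z) => [->|_]; rewrite ?conjc0 //= oppr0.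
Qed.

Lemma op_in_Roe a : Cu Z a -> uniform_Roe_algebra Z (op a).
Proof.
move=> Ca; split; first exact: op_bounded.
move=> e e0; exists (op a); first by exists a => // v; exact: opE.
apply: (@le_lt_trans _ _ 0%:E); last by rewrite lte_fin.
apply: opnorm_le => // v; rewrite expr0n mul0r.
by change (nrmsq (op a v - op a v) <= 0); rewrite subrr nrmsq0.
Qed.

Section Conjugation.
Variable Q : mat.
Hypotheses (CQ : Cu Z Q) (QQ : mprod Q (adj Q) = dg (fun=> 1))
  (QQ' : mprod (adj Q) Q = dg (fun=> 1)).

Lemma op_unitaryK : cancel (op Q) (op (adj Q)).
Proof.
move=> v; change ((op (adj Q) \o op Q) v = v).
by rewrite -op_mprod ?QQ' ?op1//; exact: Cu_adj.
Qed.

Lemma op_unitaryVK : cancel (op (adj Q)) (op Q).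
Proof.
move=> v; change ((op Q \o op (adj Q)) v = v).
by rewrite -op_mprod ?QQ ?op1//; exact: Cu_adj.
Qed.

Lemma bounded_by_conj (c : R) T : bounded_by c T ->
  bounded_by c (fun v => op (adj Q) (T (op Q v))).
Proof.
move=> Tc v; rewrite isometry_op ?adjK//; last exact: Cu_adj.
by rewrite -(isometry_op v CQ QQ').
Qed.

Lemma op_conj a v : Cu Z a ->
  op (mprod (adj Q) (mprod a Q)) v = op (adj Q) (op a (op Q v)).
Proof.
move=> Ca; rewrite op_mprod ?op_mprod//; first exact: Cu_adj.
exact: Cu_mprod.
Qed.

(** If z is not a value of f, the resolvent at z is obtained by applying
    c |-> 1 / (c - z) to the diagonal entries, and it is again an operator of
    finite propagation. *)
Lemma finite_spectrum_conj (V : seq C) (f : Z -> C) : (forall x, f x \in V) ->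
  finite_set (spectrum (uniform_Roe_algebra Z) (op (mprod (adj Q) (mprod (dg f) Q)))).
Proof.
move=> fV; apply: (@sub_finite_set _ _ [set` V]); last exact: finite_seq.
have bounded_on (g : C -> C) : exists M : R, forall x, normc (g (f x)) <= M.
  exists (\sum_(c <- undup V) normc (g c)) => x.
  rewrite (bigD1_seq (f x)) ?undup_uniq ?mem_undup//= lerDl.
  by rewrite sumr_ge0// => c _; exact: normc_ge0.
have [M fM] := bounded_on id; have Cf := Cu_dg fM.
move=> z zS; apply/negPn/negP => zV; apply: zS.
pose g (k : C) := (k - z)^-1; have [M' gM] := bounded_on g; have Cg := Cu_dg gM.
have fz x : f x - z != 0 by rewrite subr_eq0; apply: contraNneq zV => <-.
exists (op (mprod (adj Q) (mprod (dg (fun x => g (f x))) Q))).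
have opf v x : op (dg f) v x = f x * v x := op_dg _ _ fM.
have opg v x : op (dg (fun x => g (f x))) v x = g (f x) * v x := op_dg _ _ gM.
have linA a k u v : Cu Z a -> op a (u - k *: v) = op a u - k *: op a v.
  move=> Ca; have [lin _] := op_bounded Ca.
  by rewrite addrC -scaleNr lin scaleNr addrC.
have subE u v k x : (u - k *: v : ell2 R Z) x = u x - k * v x by [].
have CQ' := Cu_adj CQ.
split.
- apply: op_in_Roe; apply: Cu_mprod => //; exact: Cu_mprod.
- apply/funext => v /=; rewrite !op_conj// linA// op_unitaryVK -[RHS]op_unitaryK.
  congr (op (adj Q) _); apply: val_inj; apply/funext => x /=.
  by rewrite opg subE opf -mulrBl mulrA mulVf ?mul1r.
- apply/funext => v /=; rewrite !op_conj// op_unitaryVK -linA//.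
  rewrite -[RHS]op_unitaryK; congr (op (adj Q) _); apply: val_inj; apply/funext => x /=.
  set u := op (dg _) (op Q v); change (op (dg f) u x - z * u x = op Q v x).
  have ux : u x = g (f x) * op Q v x := opg _ _.
  by rewrite opf ux -mulrBl mulrA mulfV// mul1r.
Qed.

End Conjugation.

End MatrixAlgebra.

(** * Cutting a band matrix along segments *)

Section Segments.
Context {R : realType}.
Local Notation C := R[i].
Local Notation Z := (Zmet R).
Local Notation mat := (Z -> Z -> C).

Definition blk (L : nat) (x : Z) : int := ((x : int) %/ L%:Z)%Z.

Definition seg (L : nat) (c : int) : seq Z := [seq (c * L%:Z + i%:Z : Z) | i <- iota 0 L].

Lemma size_seg L c : size (seg L c) = L.
Proof. by rewrite size_map size_iota. Qed.

Lemma seg_uniq L c : uniq (seg L c).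
Proof. by rewrite map_inj_uniq ?iota_uniq// => i j /= /addrI; case. Qed.

Lemma nth_seg L c i : (i < L)%N -> nth (0 : Z) (seg L c) i = c * L%:Z + i%:Z :> int.
Proof. by move=> iL; rewrite (nth_map 0%N) ?size_iota// nth_iota. Qed.

Section Positive.
Variable L : nat.
Hypothesis L_gt0 : (0 < L)%N.

Lemma blk_bounds (x : Z) : (blk L x * L%:Z <= (x : int) < blk L x * L%:Z + L%:Z)%R.
Proof.
have Lz : 0 < L%:Z by lia.
have E := divz_eq (x : int) L%:Z; have := modz_ge0 (x : int) (lt0r_neq0 Lz).
have := ltz_pmod (x : int) Lz; rewrite /blk; move: E.
move: ((x : int) %/ L)%Z ((x : int) %% L)%Z => q m; lia.
Qed.

Lemma blkE (q : int) (i : nat) : (i < L)%N -> blk L (q * L%:Z + i%:Z) = q.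
Proof.
move=> iL; rewrite /blk divzMDl ?divz_small ?addr0//; lia.
Qed.

Lemma mem_seg c x : (x \in seg L c) = (blk L x == c).
Proof.
apply/mapP/eqP => [[i + ->]|<-].
  by rewrite mem_iota add0n => /andP[_ iL]; rewrite blkE.
have := blk_bounds x; move=> /andP[h1 h2].
exists (absz ((x : int) - blk L x * L%:Z)%R).
  by rewrite mem_iota; move: h1 h2; move: (blk L x * L%:Z)%R => y; lia.
by move: h1 h2; rewrite /=; move: (blk L x * L%:Z)%R => y; lia.
Qed.

Lemma blk_diam (x y : Z) : blk L x = blk L y -> (`|(x : int) - y| <= L%:Z)%R.
Proof.
move=> xy; have := blk_bounds x; have := blk_bounds y; rewrite xy.
move: (blk L y * L%:Z) => q; lia.
Qed.

End Positive.

Lemma normc_le_real (z : C) (e : R) : (- (e%:C)%C <= z <= (e%:C)%C)%R -> normc z <= e.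
Proof.
case: z => a b; rewrite !lecE /= => /andP[/andP[/eqP b0 h1] /andP[_ h2]].
rewrite oppr0 in b0; rewrite b0 expr0n addr0 sqrtr_sqr ler_norml.
by rewrite h1 h2.
Qed.

Lemma sandwich_sum (L : nat) (Y h : mat) x y : (0 < L)%N ->
  (forall x a, Y x a != 0 -> blk L x = blk L a) ->
  mprod Y (mprod h (adj Y)) x y =
  \sum_(a <- seg L (blk L x)) \sum_(b <- seg L (blk L y)) Y x a * h a b * conjc (Y y b).
Proof.
move=> L0 Ysupp.
have off z a : a \notin seg L (blk L z) -> Y z a = 0.
  by rewrite mem_seg// => za; apply: contraNeq za => /Ysupp ->.
rewrite (mprod_on _ _ (seg_uniq L (blk L x))); last by move=> a; exact: off.
apply: eq_bigr => a _; rewrite /mprod (@fsumE _ _ (seg L (blk L y))) ?seg_uniq//.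
  by rewrite mulr_sumr; apply: eq_bigr => b _; rewrite mulrA.
by move=> b /off Y0; rewrite /adj Y0 conjc0 mulr0.
Qed.

(** [almost_invariant_basis] in every segment, with one length L for all of them.
    The strict inequality N + w < L separates the rows of type true of a segment
    from the next segment. *)
Lemma adapted_blocks (h : mat) (w : nat) (eps : R) : Cu Z h -> adj h = h ->
  band w h -> 0 < eps ->
  exists (L N : nat) (Y : mat) (ty : Z -> bool), [/\ (N + w < L)%N,
    [/\ Cu Z Y, mprod Y (adj Y) = dg (fun=> 1) & mprod (adj Y) Y = dg (fun=> 1)],
    forall x a, Y x a != 0 -> blk L x = blk L a,
    forall x (a : Z), Y x a != 0 ->
      if ty x then ((a : int) < blk L a * L%:Z + N%:Z)%R
      else (blk L a * L%:Z + w%:Z <= (a : int))%R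
  & forall c (u : Z -> C),
      let O x y := if (blk L x == blk L y) && (ty x != ty y)
        then mprod Y (mprod h (adj Y)) x y else 0 in
      normc (\sum_(x <- seg L c) \sum_(y <- seg L c) u x * O x y * conjc (u y))
         <= eps * \sum_(x <- seg L c) normc (u x) ^+ 2].
Proof.
move=> Ch hh hw e0; move: (Ch) => /Cu_bandP[[M0 hM0] _].
pose M := Num.max M0 1; have M1 : 1 <= M by rewrite le_max lexx orbT.
have hM x y : normc (h x y) <= M by rewrite le_max hM0.
pose K := M * (w + w).+1%:R; have K0 : 0 < K by rewrite mulr_gt0// (lt_le_trans _ M1).
have [N NP] := almost_invariant_basis w K0 e0.
pose L := (N + w).+1; have L0 : (0 < L)%N by [].
have s_uniq := seg_uniq L; have mem_s := mem_seg L0.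
pose e c (i : 'I_(size (seg L c))) : Z := nth (0 : Z) (seg L c) i.
have eE c i : e c i = c * L%:Z + (i : nat)%:Z :> int.
  by rewrite /e nth_seg// -[X in (_ < X)%N](size_seg L c).
have be c i : blk L (e c i) = c.
  by rewrite [e c i]eE blkE// -[X in (_ < X)%N](size_seg L c).
pose H c : 'M[C]_(size (seg L c)) := \matrix_(i, k) h (e c i) (e c k).
have HP c : exists U ty, adapted N w eps (H c) U ty.
  have Hh : (H c)^t* = H c.
    by apply/matrixP => i k; rewrite !mxE -[in RHS]hh.
  have near (i k : 'I_(size (seg L c))) : ~~ ((i <= k + w) && (k <= i + w))%N -> H c i k = 0.
    move=> ik; rewrite mxE hw// !eE; move: ik.
    by move: (nat_of_ord i) (nat_of_ord k) (c * L%:Z) => i' k' q; lia.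
  apply: NP => //.
    move=> u; have KE : (K%:C = M%:C * (w + w).+1%:R)%C by rewrite /K rmorphM rmorph_nat.
    rewrite KE; apply: schur_bound => // i k; rewrite mxE.
    change (((normc (h (e c i) (e c k)))%:C <= M%:C)%C); rewrite lecR.
    exact: hM.
  by move=> i k ik; apply: near; rewrite negb_and -!ltnNge ik orbT.
pose U c := projT1 (cid (HP c)); pose ty c := projT1 (cid (projT2 (cid (HP c)))).
have UP c : adapted N w eps (H c) (U c) (ty c) := projT2 (cid (projT2 (cid (HP c)))).
move: U ty UP => U ty UP.
have UU c : U c *m (U c)^t* = 1%:M by case: (UP c).
have UU' c : (U c)^t* *m U c = 1%:M by case: (UP c).
pose Y := glue (blk L) U.
pose tyg x := if insub (index x (seg L (blk L x))) is Some i then ty (blk L x) i else false.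
have tyE c i : tyg (e c i) = ty c i.
  rewrite /tyg be /e index_uniq//; case: insubP => [i' _ ii|]; last by rewrite ltn_ord.
  by congr (ty _ _); apply: val_inj.
have YE c i k : Y (e c i) (e c k) = U c i k.
  by rewrite /Y glueE ?be// lift_mxE.
have Ysupp x a : Y x a != 0 -> blk L x = blk L a by exact: glue_supp.
have point x : exists i, x = e (blk L x) i.
  by apply: enum_seqP; rewrite mem_s.
have CY : Cu Z Y by exact (Cu_glue (blk_diam L0) s_uniq mem_s UU).
exists L, N, Y, tyg; split=> //.
- split=> //; [exact (glue_row s_uniq mem_s UU)|exact (glue_col s_uniq mem_s UU')].
- move=> x a Yxa; have xa := Ysupp _ _ Yxa.
  have [i xi] := point x; have [k ak] := point a.
  move: Yxa i xi k ak; rewrite -xa; move: (blk L x) => c Yxa i xi k ak.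
  move: Yxa; rewrite xi ak tyE YE eE; case: (UP c) => _ _ U1 U0 _.
  case: ifPn => [ti|ti] Uik.
    rewrite ltrD2l ltz_nat ltnNge; apply: contra Uik => Nk.
    by apply/eqP; exact: U1.
  rewrite lerD2l lez_nat leqNgt; apply: contra Uik => kw.
  by apply/eqP; exact: U0.
move=> c u; cbv zeta.
have GE i k : mprod Y (mprod h (adj Y)) (e c i) (e c k) = (U c *m H c *m (U c)^t*) i k.
  rewrite (sandwich_sum _ _ _ L0 Ysupp) !be mxE big_enum_seq.
  transitivity (\sum_i' \sum_k' U c i i' * H c i' k' * conjc (U c k k')); last first.
    rewrite exchange_big; apply: eq_bigr => k' _ /=.
    by rewrite !mxE mulr_suml; apply: eq_bigr => i' _; rewrite !mxE.
  apply: eq_bigr => i' _; rewrite big_enum_seq; apply: eq_bigr => k' _.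
  by rewrite -!/(e c _) !YE !mxE.
pose O (x y : Z) : C := if (blk L x == blk L y) && (tyg x != tyg y)
  then mprod Y (mprod h (adj Y)) x y else 0.
change (normc (\sum_(x <- seg L c) \sum_(y <- seg L c) u x * O x y * conjc (u y))
  <= eps * \sum_(x <- seg L c) normc (u x) ^+ 2).
pose r : 'rV[C]_(size (seg L c)) := \row_i u (e c i).
have [_ _ _ _ /(_ r)] := UP c; cbv zeta; set O' := (X in r *m X *m _) => Or.
have -> : \sum_(x <- seg L c) \sum_(y <- seg L c) u x * O x y * conjc (u y) =
    (r *m O' *m r^t*) 0 0.
  rewrite mxE exchange_big big_enum_seq; apply: eq_bigr => k _ /=.
  rewrite mxE mulr_suml big_enum_seq; apply: eq_bigr => i _.
  rewrite -!/(e c _) /O !be eqxx !tyE GE !mxE.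
  by case: (ty c i == ty c k).
apply: normc_le_real; have : ((eps * \sum_(x <- seg L c) normc (u x) ^+ 2)%:C = eps%:C * nrm2 r)%C.
  rewrite rmorphM nrm2E rmorph_sum big_enum_seq; congr (_ * _).
  by apply: eq_bigr => i _; rewrite mxE rmorphXn.
by move=> ->.
Qed.

End Segments.

(** * Approximation by operators with finite spectrum *)

Section Approximation.
Context {R : realType}.
Local Notation C := R[i].
Local Notation Z := (Zmet R).
Local Notation mat := (Z -> Z -> C).

Lemma form_bound (b : mat) (M : R) (s : seq Z) (u : Z -> C) :
  (forall x y, normc (b x y) <= M) ->
  normc (\sum_(x <- s) \sum_(y <- s) u x * b x y * conjc (u y))
    <= M * (size s)%:R * \sum_(x <- s) normc (u x) ^+ 2.
Proof.
move=> bM; have M0 : 0 <= M by apply: le_trans (bM 0 0); exact: normc_ge0.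
apply: (@le_trans _ _ (M * (\sum_(x <- s) normc (u x)) ^+ 2)); last first.
  by rewrite -mulrA ler_wpM2l// sqr_sum_le.
apply: (le_trans (normc_sum _ _)); rewrite expr2 mulr_suml mulr_sumr.
apply: ler_sum => x _; apply: (le_trans (normc_sum _ _)).
rewrite !mulr_sumr; apply: ler_sum => y _.
rewrite !Normc.normcM normc_conjc [X in X * _ <= _]mulrC -mulrA.
by rewrite ler_wpM2r// mulr_ge0 ?normc_ge0.
Qed.

(** Rounding down to multiples of eps. *)
Lemma finite_rounding (eps B : R) (f : Z -> R) : 0 < eps -> (forall z, `|f z| <= B) ->
  exists (g : Z -> R) (V : seq C), (forall z, Complex (g z) 0 \in V) /\
    forall z, `|f z - g z| <= eps.
Proof.
move=> e0 fB; pose q z := Num.floor (f z / eps); pose k := Num.bound (B / eps).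
exists (fun z => eps * (q z)%:~R).
exists [seq Complex (eps * (z : int)%:~R) 0 | z <- win (0 : Z) k].
have B0 : 0 <= B by apply: le_trans (fB 0).
have kP : B / eps < k%:R by apply: archi_boundP; rewrite divr_ge0// ltW.
have q1 z : (q z)%:~R <= f z / eps by exact: floor_le_tmp.
have q2 z : f z / eps < (q z)%:~R + 1 by rewrite -intrD1 floorD1_gt.
split=> z.
  apply/mapP; exists (q z : Z) => //; apply: mem_win.
  have := fB z; rewrite ler_norml => /andP[f1 f2].
  have f1' : - (B / eps) <= f z / eps by rewrite -mulNr ler_pM2r ?invr_gt0.
  have f2' : f z / eps <= B / eps by rewrite ler_pM2r ?invr_gt0.
  have : ((q z)%:~R : R) < (k%:Z)%:~R by rewrite -pmulrn; move: (q1 z); lra.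
  have : ((- (k%:Z) - 1)%:~R : R) < (q z)%:~R.
    by rewrite intrB intrN -pmulrn; move: (q2 z); lra.
  rewrite !ltr_int; lia.
have -> : f z - eps * (q z)%:~R = eps * (f z / eps - (q z)%:~R).
  by rewrite mulrBr mulrCA divff ?gt_eqF// mulr1.
rewrite normrM (gtr0_norm e0) -[leRHS]mulr1 ler_pM2l//.
by rewrite ler_norml; move: (q1 z) (q2 z); lra.
Qed.

Lemma normc_real (r : R) : normc (Complex r 0 : C) = `|r|.
Proof. by rewrite /= expr0n addr0 sqrtr_sqr. Qed.

Lemma linear_sub_nested (A B : ell2 R Z -> ell2 R Z) o a b : linear A -> linear B ->
  A (o + B a) - A (B b) = A (o + B (a - b)).
Proof.
move=> lA lB; have sub (D : ell2 R Z -> ell2 R Z) (lD : linear D) x x' : D (x - x') = D x - D x'.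
  by have := lD (-1) x' x; rewrite !scaleN1r ![- _ + _]addrC.
by rewrite -(sub _ lA) (sub _ lB) addrA.
Qed.

(** In the basis Y of [adapted_blocks], h becomes G.  The part O of G between types
    true and false of the same segment is small, and G' = G - O is block diagonal
    for beta, which attaches the rows of type true to the previous segment.  The
    approximation rounds the eigenvalues of G'. *)
Lemma finite_spectrum_approx (h : mat) (eps : R) : Cu Z h -> adj h = h -> 0 < eps ->
  exists s : mat, [/\ Cu Z s, adj s = s,
    finite_set (spectrum (uniform_Roe_algebra Z) (op s))
  & bounded_by (2 * eps) (fun v => op h v - op s v)].
Proof.
move=> Ch hh e0; move: (Ch) => /Cu_bandP[_ [w hw]].
have [L [N [Y [ty [NL [CY YY YY'] Ysupp Yty YO]]]]] := adapted_blocks Ch hh hw e0.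
have L0 : (0 < L)%N by apply: leq_ltn_trans NL.
have CY' := Cu_adj CY.
pose G := mprod Y (mprod h (adj Y)).
have CG : Cu Z G by do 2!apply: Cu_mprod => //.
have Gh : adj G = G.
  by rewrite /G !adj_mprod ?adjK ?hh ?mprodA//; exact: Cu_mprod.
have Ghe x y : conjc (G x y) = G y x by rewrite -[in RHS]Gh.
pose O : mat := fun x y => if (blk L x == blk L y) && (ty x != ty y) then G x y else 0.
have CO : Cu Z O.
  move: CG => /Cu_bandP[[M GM] [d Gd]]; apply/Cu_bandP; split.
    exists M => x y; rewrite /O; case: ifP => // _.
    by rewrite Normc.normc0 (le_trans _ (GM x y))// normc_ge0.
  by exists d => x y xy; rewrite /O Gd// if_same.
have Oh : adj O = O.
  apply/funext => x; apply/funext => y; rewrite /adj /O eq_sym [ty y == _]eq_sym.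
  by case: ifP => _; rewrite ?conjc0.
pose G' : mat := fun x y => G x y + (-1) * O x y.
have CG' : Cu Z G' by apply: Cu_add => //; exact: Cu_scale.
have G'h : adj G' = G'.
  apply/funext => x; apply/funext => y; rewrite /adj /G'.
  transitivity (conjc (G y x) + (-1) * conjc (O y x)).
    by rewrite rmorphD rmorphM rmorphN1.
  by rewrite Ghe -[in RHS]Oh.
pose beta x : int := if ty x then (blk L x - 1)%R else blk L x.
have diam (x y : Z) : beta x = beta y -> (`|(x : int) - y| <= (L + L)%:Z)%R.
  rewrite /beta; have := blk_bounds L0 x; have := blk_bounds L0 y.
  case: (ty x); case: (ty y) => hx hy xy.
  - have {}xy : blk L x = blk L y by lia.
    have := blk_diam L0 xy; lia.
  - have {}xy : blk L x = blk L y + 1 by lia.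
    move: hx hy; rewrite xy mulrDl mul1r; move: (blk L y * L%:Z)%R => q; lia.
  - have {}xy : blk L y = blk L x + 1 by lia.
    move: hx hy; rewrite xy mulrDl mul1r; move: (blk L x * L%:Z)%R => q; lia.
  - have := blk_diam L0 xy; lia.
(* An entry of G between distinct segments involves two integers a and b at
   distance at most w in consecutive segments: the left one is in the last w
   places of its segment, the right one in the first w places.  Hence the left
   row has type false and the right row has type true. *)
have G'0 x y : beta x != beta y -> G' x y = 0.
  move=> xy; rewrite /G' /O.
  have [bxy|bxy] /= := eqVneq (blk L x) (blk L y).
    case: ifPn => [_|]; first by rewrite mulN1r subrr.
    by rewrite negbK => /eqP txy; move: xy; rewrite /beta bxy txy eqxx.
  rewrite mulr0 addr0 /G (sandwich_sum _ _ _ L0 Ysupp).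
  apply: big1 => a _; apply: big1 => b _; apply/eqP/negPn/negP => nz.
  have Yxa : Y x a != 0 by apply: contraNneq nz => ->; rewrite !mul0r.
  have hab : h a b != 0 by apply: contraNneq nz => ->; rewrite mulr0 mul0r.
  have Yyb : Y y b != 0 by apply: contraNneq nz => ->; rewrite conjc0 mulr0.
  have ab : (`|(a : int) - b| <= w%:Z)%R.
    by rewrite leNgt; apply: contra hab => /hw ->.
  have := Yty _ _ Yxa; have := Yty _ _ Yyb.
  have := blk_bounds L0 a; have := blk_bounds L0 b.
  move: xy bxy; rewrite /beta (Ysupp _ _ Yxa) (Ysupp _ _ Yyb).
  move: (blk L a) (blk L b) => p q.
  have [pq|pq|pq] // := ltgtP p q.
  - have : (p * L%:Z + L%:Z <= q * L%:Z)%R by nia.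
    have : (q != p + 1 -> p * L%:Z + L%:Z + L%:Z <= q * L%:Z)%R by nia.
    move: (p * L%:Z)%R (q * L%:Z)%R => p' q'.
    by case: (ty x); case: (ty y); lia.
  - have : (q * L%:Z + L%:Z <= p * L%:Z)%R by nia.
    have : (p != q + 1 -> q * L%:Z + L%:Z + L%:Z <= p * L%:Z)%R by nia.
    move: (p * L%:Z)%R (q * L%:Z)%R => p' q'.
    by case: (ty x); case: (ty y); lia.
have O0 x y : blk L x != blk L y -> O x y = 0 by rewrite /O => /negPf ->.
(* O is diagonalized only to pass from the bound on the quadratic forms of its
   blocks to a bound on its norm. *)
have [Y2 [f2 [CY2 YY2 YY2' OE f2P]]] :=
  block_diagonalize (blk_diam L0) (seg_uniq L) (mem_seg L0) Oh O0.
have f2e z : normc (Complex (f2 z) 0 : C) <= eps.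
  by rewrite normc_real; apply: f2P => c u; exact: YO.
have Oeps : bounded_by eps (op O).
  move=> v; rewrite OE op_conj//; last exact: Cu_dg f2e.
  exact (bounded_by_conj CY2 YY2 YY2' (bounded_by_dg f2e) v).
have [s2 s2P] := class_enum diam.
have s2_uniq c : uniq (s2 c) by case: (s2P c).
have mem_s2 c x : (x \in s2 c) = (beta x == c) by case: (s2P c).
have [Y3 [f3 [CY3 YY3 YY3' G'E f3P]]] := block_diagonalize diam s2_uniq mem_s2 G'h G'0.
have size_s2 c : (size (s2 c) <= (L + L + (L + L)).+1)%N.
  case E : (s2 c) => [//|x0 r]; rewrite -E -(size_win x0 (L + L)).
  apply: uniq_leq_size => // x; rewrite mem_s2 => /eqP xc; apply: mem_win; apply: diam.
  by rewrite xc; apply/eqP; rewrite -mem_s2 E mem_head.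
have [[M G'M] _] := proj1 (Cu_bandP G') CG'.
have f3B z : `|f3 z| <= M * ((L + L + (L + L)).+1)%:R.
  apply: f3P => c u; apply: (le_trans (form_bound (s2 c) u G'M)).
  rewrite ler_wpM2r ?sumr_ge0// => [x _|]; first exact: sqr_ge0.
  by rewrite ler_wpM2l ?ler_nat// (le_trans _ (G'M 0 0))// normc_ge0.
have [g [V [gV fg]]] := finite_rounding e0 f3B.
pose Q := mprod Y3 Y; have CQ : Cu Z Q by exact: Cu_mprod.
have CY3' := Cu_adj CY3; have CQ' := Cu_adj CQ.
have QE : adj Q = mprod (adj Y) (adj Y3) by rewrite adj_mprod.
have QQ : mprod Q (adj Q) = dg (fun=> 1).
  by rewrite QE /Q mprodA// -(mprodA _ CY CY') YY mprod1l YY3.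
have QQ' : mprod (adj Q) Q = dg (fun=> 1).
  by rewrite QE /Q mprodA// -(mprodA _ CY3' CY3) YY3' mprod1l YY'.
pose gC (z : Z) : C := Complex (g z) 0; pose fC (z : Z) : C := Complex (f3 z) 0.
have fM z : normc (fC z) <= M * ((L + L + (L + L)).+1)%:R by rewrite normc_real.
have gM z : normc (gC z) <= M * ((L + L + (L + L)).+1)%:R + eps.
  rewrite normc_real; have := fg z; have := f3B z.
  have := ler_normB (f3 z) (f3 z - g z); rewrite subKr; lra.
have Cg := Cu_dg gM; have Cf := Cu_dg fM.
exists (mprod (adj Q) (mprod (dg gC) Q)); split.
- by apply: Cu_mprod => //; exact: Cu_mprod.
- rewrite !adj_mprod ?adjK ?adj_dg_real ?mprodA//; exact: Cu_mprod.
- exact: (finite_spectrum_conj CQ QQ QQ' gV).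
pose T u := op O u + op (adj Y3) (op (dg (fun z => fC z - gC z)) (op Y3 u)).
have fgC z : normc (fC z - gC z) <= eps.
  have -> : fC z - gC z = Complex (f3 z - g z) 0.
    by apply/eqP; rewrite eq_complex /= subr0 !eqxx.
  by rewrite normc_real.
have Te : bounded_by (2 * eps) T.
  move=> u; apply: (le_trans (nrmsqD_le _ _)).
  have := Oeps u; have := bounded_by_conj CY3 YY3 YY3' (bounded_by_dg fgC) u.
  rewrite exprMn; lra.
suff E v : op h v - op (mprod (adj Q) (mprod (dg gC) Q)) v = op (adj Y) (T (op Y v)).
  by move=> v; rewrite E; exact (bounded_by_conj CY YY YY' Te v).
have GO u : op G u = op O u + op G' u.
  rewrite -op_add//; congr (op _ u); apply/funext => x; apply/funext => y.
  by rewrite /G' mulN1r addrCA subrr addr0.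
have hG : op h v = op (adj Y) (op G (op Y v)).
  have CYh := Cu_mprod Ch CY'.
  have -> : op G = op Y \o (op h \o op (adj Y)).
    exact (etrans (op_mprod CY CYh) (congr1 (comp (op Y)) (op_mprod Ch CY'))).
  have K := op_unitaryK CY YY'.
  exact (esym (etrans (K _) (congr1 (op h) (K v)))).
pose y := op Y v; pose u := op Y3 y.
have E1 : op G' y = op (adj Y3) (op (dg fC) u).
  exact (etrans (congr1 (fun b => op b y) G'E) (op_conj CY3 y Cf)).
have EQ : op Q v = u := congr1 (fun f => f v) (op_mprod CY3 CY).
have EQ' x : op (adj Q) x = op (adj Y) (op (adj Y3) x).
  exact (etrans (congr1 (fun b => op b x) QE) (congr1 (fun f => f x) (op_mprod CY' CY3'))).
have E2 : op (mprod (adj Q) (mprod (dg gC) Q)) v = op (adj Y) (op (adj Y3) (op (dg gC) u)).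
  apply: etrans (op_conj CQ v Cg) _; apply: etrans (EQ' _).
  exact (congr1 (fun x => op (adj Q) (op (dg gC) x)) EQ).
have E3 : op (dg fC) u - op (dg gC) u = op (dg (fun z => fC z - gC z)) u.
  apply: val_inj; apply/funext => x.
  change (op (dg fC) u x - op (dg gC) u x = op (dg (fun z => fC z - gC z)) u x).
  by rewrite (op_dg _ _ fM) (op_dg _ _ gM) (op_dg _ _ fgC) mulrBl.
have E4 : op h v = op (adj Y) (op O y + op (adj Y3) (op (dg fC) u)).
  apply: etrans hG _; apply: (congr1 (op (adj Y))).
  exact (etrans (GO y) (congr1 (fun x => op O y + x) E1)).
have [linY _] := op_bounded CY'; have [linY3 _] := op_bounded CY3'.
apply: etrans (congr2 (fun x x' => x - x') E4 E2) _.
apply: etrans (linear_sub_nested _ _ _ linY linY3) _.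
exact (congr1 (fun x => op (adj Y) (op O y + op (adj Y3) x)) E3).
Qed.

End Approximation.

Theorem corollary4p7 (R : realType) :
  real_rank_zero (uniform_Roe_algebra (Zmet R)).
Proof.
move=> T [bT Tapp] Tsa e e0.
have [S0 [a Ca S0a] S0T] := Tapp (e / 4) (divr_gt0 e0 (ltr0n _ 4)).
have S0E : S0 = op a by apply/funext => v; apply: val_inj; rewrite /= S0a opE.
have Ca' := Cu_adj Ca; have e4 : 0 < e / 4 by rewrite divr_gt0.
pose X v := T v - op a v; pose X' v := T v - op (adj a) v.
have [linT _] := bT; have [lina _] := op_bounded Ca.
have linX : linear X.
  move=> k u v; rewrite /X linT lina opprD scalerBr.
  by rewrite addrACA.
have Xb : bounded_by (e / 4) X.
  apply: bounded_by_opnorm => //; first exact: ltW.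
  by move: S0T; rewrite S0E => /ltW.
have X'b : bounded_by (e / 4) X'.
  apply: (bounded_by_adjoint e4 _ Xb) => v w.
  by rewrite /X /X' innerBl innerBr Tsa inner_op.
(* The approximating matrix a need not be self-adjoint; X' is the adjoint of X,
   so that averaging a with its adjoint costs nothing. *)
pose half : R[i] := 2^-1.
pose h x y := half * a x y + half * adj a x y.
have Cha : Cu (Zmet R) (fun x y => half * a x y) by exact: Cu_scale.
have Cha' : Cu (Zmet R) (fun x y => half * adj a x y) by exact: Cu_scale.
have Ch : Cu (Zmet R) h by exact: Cu_add.
have hh : adj h = h.
  have half_real : conjc half = half by rewrite /half fmorphV rmorph_nat.
  have cj p q : conjc (half * p + half * conjc q) = conjc half * q + conjc half * conjc p.
    by rewrite rmorphD !rmorphM /= conjcK addrC.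
  by apply/funext => x; apply/funext => y; rewrite /adj /h cj half_real.
have Th v : T v - op h v = half *: X v + half *: X' v.
  rewrite /h op_add// !op_scale// /X /X' !scalerBr addrACA -scalerDl opprD.
  have -> : half + half = 1 by have := splitr (1 : R[i]); rewrite !mul1r => <-.
  by rewrite scale1r.
have [s [Cs sh fs hs]] := finite_spectrum_approx Ch hh (divr_gt0 e0 (ltr0n R 8)).
exists (op s); split; [exact: op_in_Roe|exact: selfadjoint_op|exact: fs|].
apply: (@le_lt_trans _ _ (e / 2)%:E); last by rewrite lte_fin ltr_pdivrMr//; lra.
apply: opnorm_le => [|v]; first by rewrite divr_ge0// ltW.
have -> : (T \- op s) v = (T v - op h v) + (op h v - op s v).
  by rewrite addrA subrK.
apply: (le_trans (nrmsqD_le _ _)); rewrite Th.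
have := bounded_by_avg Xb X'b v; have := hs v; rewrite -/half.
have -> : (2 * (e / 8)) ^+ 2 = (e / 4) ^+ 2 by congr (_ ^+ 2); field.
have -> : (e / 2) ^+ 2 = 4 * (e / 4) ^+ 2 by field.
by set q := (e / 4) ^+ 2; set n := nrmsq v; lra.
Qed.
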